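(* Let $d\in\mathbb{N}$. (a) If $L$ is a $d$-dimensional multivariate subordinator with finite second moments, then $\mathrm{var}(L_1)$ is completely positive. (b) If $C\in M_d(\mathbb{R})$ is completely positive, there exists a $d$-dimensional multivariate subordinator $L$ such that $C=\mathrm{var}(L_1)$. (c) For $C\in M_d(\mathbb{R})$ there exists a $d$-dimensional multivariate subordinator $L$ with $\mathrm{var}(L_1)=C$ if and only if $C$ is completely positive. (d) Provided $d\le 4$, there exists a $d$-dimensional multivariate subordinator $L$ with $\mathrm{var}(L_1)=C$ if and only if $C\in M_d(\mathbb{R})$ is doubly non-negative.
   Context: $M_d(\mathbb{R})$ is the set of real $d\times d$ matrices and $M_{d,k}(\mathbb{R})$ the set of real $d\times k$ matrices. A $d$-dimensional multivariate subordinator is a $d$-dimensional Lévy process all of whose components are univariate Lévy subordinators (i.e. non-decreasing real Lévy processes). $\mathrm{var}(L_1)$ is the $d\times d$ covariance matrix of the random vector $L_1$; writing $\mathrm{var}(L_1)=C$ includes that $L_1$ has finite second moments. A matrix $C\in M_d(\mathbb{R})$ is called completely positive if there exist $k\in\mathbb{N}$ and $B\in M_{d,k}(\mathbb{R})$ with all entries non-negative such that $C=BB^{\mathrm{T}}$. It is called doubly non-negative if it is (symmetric) positive semidefinite and all its entries are non-negative. *)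

(* Defs.v *)
From mathcomp Require Export all_boot all_order all_algebra.
From mathcomp Require Export all_classical all_reals all_analysis.

Set Implicit Arguments.
Unset Strict Implicit.
Unset Printing Implicit Defensive.

Import Order.TTheory GRing.Theory Num.Theory.
Import numFieldNormedType.Exports.

Local Open Scope classical_set_scope.
Local Open Scope ring_scope.

Definition completely_positive (R : realType) (d : nat) (C : 'M[R]_d) : Prop :=
  exists (k : nat) (B : 'M[R]_(d, k)),
    (forall i j, 0 <= B i j) /\ C = B *m B^T.

Definition positive_semidefinite (R : realType) (d : nat) (C : 'M[R]_d) : Prop :=
  C^T = C /\ forall x : 'cV[R]_d, 0 <= (x^T *m C *m x) 0 0.

Definition doubly_nonnegative (R : realType) (d : nat) (C : 'M[R]_d) : Prop :=
  positive_semidefinite C /\ forall i j, 0 <= C i j.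

Definition borel (R : realType) (d : nat) : set (set 'cV[R]_d) := <<s open >>.

Definition random_vector (disp : measure_display) (T : measurableType disp)
    (R : realType) (d : nat) (X : T -> 'cV[R]_d) : Prop :=
  forall B, borel B -> measurable (X @^-1` B).

(* The product rule for the full family suffices, since each B k may be the
   whole space. *)
Definition independent (disp : measure_display) (T : measurableType disp)
    (R : realType) (P : probability T R) (d n : nat)
    (X : nat -> T -> 'cV[R]_d) : Prop :=
  forall B : nat -> set 'cV[R]_d,
    (forall k, (k < n)%N -> borel (B k)) ->
    P (\bigcap_(k < n) (X k @^-1` B k)) = (\prod_(k < n) P (X k @^-1` B k))%E.

Definition same_law (disp : measure_display) (T : measurableType disp)
    (R : realType) (P : probability T R) (d : nat)
    (X Y : T -> 'cV[R]_d) : Prop :=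
  forall B, borel B -> P (X @^-1` B) = P (Y @^-1` B).

Definition independent_increments (disp : measure_display)
    (T : measurableType disp) (R : realType) (P : probability T R) (d : nat)
    (L : R -> T -> 'cV[R]_d) : Prop :=
  forall (n : nat) (t : nat -> R),
    0 <= t 0%N -> (forall k, (k < n)%N -> t k < t k.+1) ->
    independent P n (fun k w => L (t k.+1) w - L (t k) w).

Definition stationary_increments (disp : measure_display)
    (T : measurableType disp) (R : realType) (P : probability T R) (d : nat)
    (L : R -> T -> 'cV[R]_d) : Prop :=
  forall s t : R, 0 <= s -> 0 <= t ->
    same_law P (fun w => L (s + t) w - L s w) (fun w => L t w - L 0 w).

Definition stochastically_continuous (disp : measure_display)
    (T : measurableType disp) (R : realType) (P : probability T R) (d : nat)
    (L : R -> T -> 'cV[R]_d) : Prop :=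
  forall t e : R, 0 <= t -> 0 < e ->
    P [set w | e < `|L s w - L t w|]
      @[s --> within [set s | 0 <= s] (nbhs t)] --> 0%E.

Definition cadlag (R : realType) (d : nat) (f : R -> 'cV[R]_d) : Prop :=
  (forall t : R, 0 <= t -> f s @[s --> t^'+] --> f t) /\
  (forall t : R, 0 < t -> cvg (f s @[s --> t^'-])).

(* The time set is [0, +oo[: the values of L at negative times are irrelevant
   in all the conditions. *)
Definition levy_process (disp : measure_display) (T : measurableType disp)
    (R : realType) (P : probability T R) (d : nat)
    (L : R -> T -> 'cV[R]_d) : Prop :=
  [/\ forall t : R, 0 <= t -> random_vector (L t),
      {ae P, forall w, L 0 w = 0},
      independent_increments P L /\ stationary_increments P L,
      stochastically_continuous P L
    & {ae P, forall w, cadlag (L ^~ w)}].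

(* A real process is viewed as a process in dimension 1. *)
Definition subordinator (disp : measure_display) (T : measurableType disp)
    (R : realType) (P : probability T R) (X : R -> T -> R) : Prop :=
  levy_process P (fun t w => const_mx (X t w) : 'cV[R]_1) /\
  {ae P, forall w, forall s t : R, 0 <= s -> s <= t -> X s w <= X t w}.

Definition multivariate_subordinator (disp : measure_display)
    (T : measurableType disp) (R : realType) (P : probability T R) (d : nat)
    (L : R -> T -> 'cV[R]_d) : Prop :=
  levy_process P L /\ forall i, subordinator P (fun t w => L t w i 0).

Definition finite_second_moments (disp : measure_display)
    (T : measurableType disp) (R : realType) (P : probability T R) (d : nat)
    (X : T -> 'cV[R]_d) : Prop :=
  forall i, (fun w => X w i 0) \in Lfun P 2%:E.

(* Meaningful when X has finite second moments: the covariances are then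
   finite, so that fine loses no information. *)
Definition var (disp : measure_display) (T : measurableType disp)
    (R : realType) (P : probability T R) (d : nat)
    (X : T -> 'cV[R]_d) : 'M[R]_d :=
  \matrix_(i, j) fine (covariance P (fun w => X w i 0) (fun w => X w j 0)).

Definition is_var_of_subordinator (R : realType) (d : nat)
    (C : 'M[R]_d) : Prop :=
  exists (disp : measure_display) (T : measurableType disp)
         (P : probability T R) (L : R -> T -> 'cV[R]_d),
    [/\ multivariate_subordinator P L,
        finite_second_moments P (L 1)
      & var P (L 1) = C].

(* Main.v *)
From HB Require Import structures.
Require Import Defs.
From mathcomp Require Import measurable_realfun zify ring lra.
Import Order.TTheory GRing.Theory Num.Theory.
Import numFieldNormedType.Exports.
Local Open Scope classical_set_scope.
Local Open Scope ring_scope.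

Set Implicit Arguments.
Unset Strict Implicit.
Unset Printing Implicit Defensive.

(** Why the theorem holds.

    Covariance matrices are completely positive.  Let [L] be a subordinator
    with finite second moments and [X_h = L_h - L_0], a vector with almost
    surely non-negative entries.  The increments of [L] over [[0, h]] and
    [[h, 2h]] are independent with the same law, hence [E X_2h = 2 E X_h] and
    [var X_2h = 2 var X_h].  With [h = 2^-n] this gives
    [var L_1 = 2^n E[X_h X_h^T] - 2^-n E[L_1] E[L_1]^T] (see
    [dyadic_scaling]), so that [var L_1] is the limit of the matrices
    [2^n E[X_h X_h^T]].  The matrix of second moments of a non-negative random
    vector is completely positive ([completely_positive_second_moment]): for a
    vector with finitely many values [v] it is the sum of the [P(v) v v^T],
    and the general case follows by discretization.  Both limits stay in the
    cone of completely positive matrices because that cone is closed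
    ([completely_positive_closed]).

    Every completely positive matrix occurs.  If [C] is the sum of the
    [b_j b_j^T], let [L] jump by [b_j] at the points of a Poisson process of
    rate 1, independently for each [j].  Then [L_1] has covariance matrix [C]
    ([word_second_moment]).  All the randomness comes from one uniform variable
    on [[0, 1]]: its binary digits of even and of odd rank give two independent
    uniform variables, its head and its tail ([uniform_head_tail]).  The head
    determines the time and the mark [j] of the first jump, the tail determines
    what follows in the same way.  The joint law of the jumps in successive
    time intervals is computed by induction on the number of jumps
    ([history_prob]): given that the first one occurs at time [x], the rest of
    the history is a history of the process built on the tail, shifted by [x].
    Independence and stationarity of the increments can be read off the
    resulting product formula ([word_joint]).

    In dimension at most 4, doubly non-negative matrices are completely
    positive ([doubly_nonnegative_completely_positive]).  Subtracting from [C]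
    a suitable multiple of [v v^T], with [v] a column of [C], produces a
    doubly non-negative matrix with a zero entry off the diagonal.  When
    [C i j = 0], eliminating [i] and [j] leaves two rank one terms and a
    positive semidefinite matrix on the two remaining indices, whose only
    possibly negative entry can be shared out between the rank one terms
    ([completely_positive_zero_entry]). *)

(** * Completely positive and doubly non-negative matrices *)

Lemma completely_positive0 (R : realType) d : completely_positive (0 : 'M[R]_d).
Proof.
exists 0%N, 0; split; last by rewrite mul0mx.
by move=> i j; rewrite mxE.
Qed.

Lemma completely_positiveD (R : realType) d (C D : 'M[R]_d) :
  completely_positive C -> completely_positive D -> completely_positive (C + D).
Proof.
move=> [k [B [B0 ->]]] [l [E [E0 ->]]].
exists (k + l)%N, (row_mx B E); split; last by rewrite tr_row_mx mul_row_col.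
by move=> i j; rewrite mxE; case: (fintype.split j) => a.
Qed.

Lemma completely_positive_col (R : realType) d (b : 'cV[R]_d) :
  (forall i, 0 <= b i 0) -> completely_positive (b *m b^T).
Proof. by move=> b0; exists 1%N, b; split=> // i j; rewrite (ord1 j). Qed.

Lemma completely_positiveZ (R : realType) d (a : R) (C : 'M[R]_d) :
  0 <= a -> completely_positive C -> completely_positive (a *: C).
Proof.
move=> a0 [k [B [B0 ->]]]; exists k, (Num.sqrt a *: B); split.
  by move=> i j; rewrite mxE mulr_ge0 ?sqrtr_ge0.
by rewrite linearZ /= -scalemxAl -scalemxAr scalerA -expr2 sqr_sqrtr.
Qed.

Lemma completely_positive_sum (R : realType) d (I : Type) (r : seq I)
    (C : I -> 'M[R]_d) :
  (forall i, completely_positive (C i)) -> completely_positive (\sum_(i <- r) C i).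
Proof.
move=> CP; apply: big_ind => //; first exact: completely_positive0.
exact: completely_positiveD.
Qed.

Lemma completely_positive_doubly_nonnegative (R : realType) d (C : 'M[R]_d) :
  completely_positive C -> doubly_nonnegative C.
Proof.
move=> [k [B [B0 ->]]]; split; last first.
  by move=> i j; rewrite mxE sumr_ge0// => l _; rewrite mxE mulr_ge0.
split; first by rewrite trmx_mul trmxK.
move=> x; rewrite mulmxA -mulmxA -{1}(trmxK B) -trmx_mul mxE sumr_ge0// => l _.
by rewrite [_^T 0 l]mxE -expr2 sqr_ge0.
Qed.

Lemma positive_semidefiniteD (R : realType) d (C D : 'M[R]_d) :
  positive_semidefinite C -> positive_semidefinite D ->
  positive_semidefinite (C + D).
Proof.
move=> [Cs C0] [Ds D0]; split; first by rewrite linearD /= Cs Ds.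
by move=> x; rewrite mulmxDr mulmxDl mxE addr_ge0.
Qed.

Lemma positive_semidefiniteZ (R : realType) d (a : R) (C : 'M[R]_d) :
  0 <= a -> positive_semidefinite C -> positive_semidefinite (a *: C).
Proof.
move=> a0 [Cs C0]; split; first by rewrite linearZ /= Cs.
by move=> x; rewrite -scalemxAr -scalemxAl mxE mulr_ge0.
Qed.

Lemma positive_semidefinite_col (R : realType) d (b : 'cV[R]_d) :
  positive_semidefinite (b *m b^T).
Proof.
split; first by rewrite trmx_mul trmxK.
move=> x; rewrite mulmxA -mulmxA -{1}(trmxK b) -trmx_mul mxE sumr_ge0// => l _.
by rewrite [_^T 0 l]mxE -expr2 sqr_ge0.
Qed.

Lemma psd_symE (R : realType) d (C : 'M[R]_d) i j :
  positive_semidefinite C -> C i j = C j i.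
Proof. by move=> [Cs _]; rewrite -[in LHS]Cs mxE. Qed.

(** A quadratic polynomial in [t]: its being non-negative gives the 2 x 2 minors,
    its minimum gives the Schur complement. *)
Lemma quadratic_form_line (R : realType) d (C : 'M[R]_d) (x : 'cV[R]_d) p t :
  C^T = C ->
  let y := x + t *: delta_mx p 0 in
  (y^T *m C *m y) 0 0 =
    (x^T *m C *m x) 0 0 + 2 * t * (C *m x) p 0 + t ^+ 2 * C p p.
Proof.
move=> Cs y; rewrite /y.
have e1 : (delta_mx p 0 : 'cV[R]_d)^T *m (C *m x) = (C *m x) p 0 *: 1%:M.
  rewrite trmx_delta -rowE; apply/matrixP => a b.
  by rewrite !mxE (ord1 a) (ord1 b) eqxx mulr1.
have e2 : x^T *m (C *m (delta_mx p 0 : 'cV[R]_d)) = (C *m x) p 0 *: 1%:M.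
  apply: trmx_inj; rewrite !trmx_mul trmxK Cs -mulmxA e1.
  by rewrite linearZ /= tr_scalar_mx.
have e3 : (delta_mx p 0 : 'cV[R]_d)^T *m (C *m (delta_mx p 0 : 'cV[R]_d)) =
    C p p *: 1%:M.
  rewrite trmx_delta -rowE -colE; apply/matrixP => a b.
  by rewrite !mxE (ord1 a) (ord1 b) eqxx mulr1.
rewrite -!mulmxA linearD linearZ /= mulmxDl mulmxDr mulmxDr mulmxDr.
rewrite -!scalemxAl -!scalemxAr e1 e2 e3 !mxE /= !mulr1n; ring.
Qed.

Lemma psd_diag_ge0 (R : realType) d (C : 'M[R]_d) i :
  positive_semidefinite C -> 0 <= C i i.
Proof.
move=> [Cs /(_ (0 + 1 *: delta_mx i 0))].
rewrite quadratic_form_line// !mulmx0 [X in X + _ + _]mxE.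
by rewrite [X in _ * X]mxE expr1n mulr0 !add0r mul1r.
Qed.

Lemma psd_minor2 (R : realType) d (C : 'M[R]_d) i j :
  positive_semidefinite C -> C i j ^+ 2 <= C i i * C j j.
Proof.
move=> Cp; have [Cs C0] := Cp.
have q a b : 0 <= a ^+ 2 * C i i + 2 * a * b * C i j + b ^+ 2 * C j j.
  have := C0 ((0 + a *: delta_mx i 0) + b *: delta_mx j 0).
  rewrite !quadratic_form_line// !mulmx0 add0r -scalemxAr -colE.
  rewrite !mxE (psd_symE j i Cp) => h; nra.
have cj := psd_diag_ge0 j Cp; have ci := psd_diag_ge0 i Cp.
have [cj0|] := ltrP 0 (C j j).
  have := q (C j j) (- C i j) => h.
  rewrite -subr_ge0 -(pmulr_rge0 _ cj0); nra.
move=> cjle; have cj0 : C j j = 0 by apply/le_anti; rewrite cj cjle.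
rewrite cj0 mulr0.
have h := q (C i j) (- (C i i + 1)); rewrite cj0 in h.
nra.
Qed.

(** As [0^-1 = 0], a zero pivot leaves the matrix unchanged; the pivot row of a
    positive semidefinite matrix is then already zero. *)
Definition schur_complement (R : realType) d (C : 'M[R]_d) p : 'M[R]_d :=
  C - (C p p)^-1 *: (col p C *m (col p C)^T).

Lemma schur_complementE (R : realType) d (C : 'M[R]_d) p i j :
  schur_complement C p i j = C i j - (C p p)^-1 * (C i p * C j p).
Proof. by rewrite !mxE big_ord1 !mxE. Qed.

(** The value of the form of the Schur complement at [x] is the minimum over [t]
    of the form of [C] at [x + t e_p]. *)
Lemma psd_schur_complement (R : realType) d (C : 'M[R]_d) p :
  positive_semidefinite C -> positive_semidefinite (schur_complement C p).
Proof.
move=> Cp; have [Cs C0] := Cp; split.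
  apply/matrixP => i j; rewrite mxE !schur_complementE (psd_symE i j Cp).
  by rewrite (mulrC (C i p)).
move=> x; rewrite /schur_complement mulmxBr mulmxBl -scalemxAr -scalemxAl.
have e : x^T *m (col p C *m (col p C)^T) *m x = ((C *m x) p 0) ^+ 2 *: 1%:M.
  have e1 : (col p C)^T *m x = (C *m x) p 0 *: 1%:M.
    rewrite tr_col Cs -row_mul; apply/matrixP => a b.
    by rewrite !mxE (ord1 a) (ord1 b) eqxx mulr1.
  have e2 : x^T *m col p C = (C *m x) p 0 *: 1%:M.
    by apply: trmx_inj; rewrite trmx_mul trmxK e1 linearZ /= tr_scalar_mx.
  rewrite mulmxA -mulmxA e1 e2 -scalemxAl -scalemxAr mul1mx scalerA.
  by rewrite expr2.
rewrite mxE [X in _ + X]mxE [X in - X]mxE e [X in _ * X]mxE [X in _ * (_ * X)]mxE mulr1.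
have [->|cpp] := eqVneq (C p p) 0; first by rewrite invr0 mul0r subr0.
have := C0 (x + (- ((C *m x) p 0 / C p p)) *: delta_mx p 0).
rewrite quadratic_form_line//; congr (_ <= _); field.
exact: cpp.
Qed.

Lemma schur_complement_pivot (R : realType) d (C : 'M[R]_d) p j :
  positive_semidefinite C -> schur_complement C p p j = 0.
Proof.
move=> Cp; rewrite schur_complementE (psd_symE j p Cp).
have [e|cpp] := eqVneq (C p p) 0.
  have := psd_minor2 p j Cp; rewrite e mul0r exprn_even_le0//= => /eqP ->.
  by rewrite !mulr0 subr0.
by field.
Qed.

(** Elimination step: the subtracted term is a non-negative multiple of
    [v v^T], where [v] is the pivot column. *)
Lemma completely_positive_schur (R : realType) d (C : 'M[R]_d) p :
  positive_semidefinite C -> (forall i, 0 <= C i p) ->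
  completely_positive (schur_complement C p) -> completely_positive C.
Proof.
move=> Cp C0 CS.
rewrite -[C](subrK ((C p p)^-1 *: (col p C *m (col p C)^T))).
apply: completely_positiveD => //.
apply: completely_positiveZ; first by rewrite invr_ge0.
by apply: completely_positive_col => i; rewrite mxE.
Qed.

Lemma completely_positive_support2 (R : realType) d (D : 'M[R]_d) i k :
  positive_semidefinite D -> 0 <= D i k ->
  (forall a b, a \notin [:: i; k] -> D a b = 0) ->
  completely_positive D.
Proof.
move=> Dp ik0 supp.
have Di a : 0 <= D a i.
  have [|/supp->//] := boolP (a \in [:: i; k]).
  rewrite !inE => /orP[|] /eqP->; first exact: psd_diag_ge0.
  by rewrite (psd_symE _ _ Dp).
apply: (completely_positive_schur Dp Di).
set S := schur_complement D i.
have Sp : positive_semidefinite S by exact: psd_schur_complement.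
have S0 a b : a != k -> S a b = 0.
  move=> ak; have [->|ai] := eqVneq a i; first exact: schur_complement_pivot.
  have aik : a \notin [:: i; k] by rewrite !inE negb_or ai.
  by rewrite /S schur_complementE !(supp a)// mul0r mulr0 subr0.
clearbody S => {D Dp ik0 supp Di}.
have -> : S = S k k *: (delta_mx k 0 *m (delta_mx k 0 : 'cV[R]_d)^T).
  apply/matrixP => a b; rewrite [RHS]mxE [X in _ * X]mxE big_ord1 ![in RHS]mxE !andbT.
  have [->|ak] := eqVneq a k; last by rewrite S0// mul0r mulr0.
  have [->|bk] := eqVneq b k; first by rewrite !mulr1.
  by rewrite (psd_symE _ _ Sp) S0// !mulr0.
apply: completely_positiveZ; first exact: psd_diag_ge0.
by apply: completely_positive_col => a; rewrite mxE.
Qed.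

(** For a unit diagonal the last hypothesis reads [D j k <= D i j * D i k], whence
    [D i j * D j k <= (D i j)^2 * D i k <= D i k]: eliminating [j] keeps the entry
    at [(i, k)] non-negative and leaves a matrix supported by two indices. *)
Lemma completely_positive_support3 (R : realType) d (D : 'M[R]_d) i j k :
  positive_semidefinite D -> (forall a b, 0 <= D a b) ->
  (forall a b, a \notin [:: i; j; k] -> D a b = 0) ->
  D j k * D i i <= D i j * D i k ->
  completely_positive D.
Proof.
move=> Dp D0 supp jk.
apply: (completely_positive_schur Dp (fun a => D0 a j)).
apply: (@completely_positive_support2 _ _ _ i k).
- exact: psd_schur_complement.
- rewrite schur_complementE (psd_symE k j Dp).
  have [->|jj] := eqVneq (D j j) 0; first by rewrite invr0 mul0r subr0.
  have jj0 : 0 < D j j by rewrite lt_def jj D0.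
  rewrite subr_ge0 mulrC ler_pdivrMr//.
  have m := psd_minor2 i j Dp.
  have [ii|ii] := eqVneq (D i i) 0.
    move: m; rewrite ii mul0r exprn_even_le0//= => /eqP->.
    by rewrite mul0r mulr_ge0.
  have ii0 : 0 < D i i by rewrite lt_def ii D0.
  rewrite -(ler_pM2r ii0) -mulrA.
  apply: (@le_trans _ _ (D i j * (D i j * D i k))); first exact: ler_wpM2l.
  by have := ler_wpM2r (D0 i k) m; lra.
- move=> a b; rewrite !inE negb_or => /andP[ai ak].
  have [->|aj] := eqVneq a j; first exact: schur_complement_pivot.
  have aijk : a \notin [:: i; j; k] by rewrite !inE !negb_or ai aj.
  by rewrite schur_complementE !(supp a)// mul0r mulr0 subr0.
Qed.

(** Since [C i j = 0], eliminating [i] and then [j] writes [C] as [Pi + Pj + N],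
    with [Pi], [Pj] of rank one and non-negative, and [N] positive semidefinite
    and supported by [k], [l].  If [N k l < 0], this negative entry is compensated
    by [Pi k l + Pj k l]; distributing [N] over [Pi] and [Pj] in the proportion of
    these two entries makes both sums doubly non-negative, each with a support of
    three indices. *)
Lemma completely_positive_zero_entry (R : realType) d (C : 'M[R]_d) i j k l :
  doubly_nonnegative C -> i != j -> C i j = 0 ->
  (forall a, a \in [:: i; j; k; l]) -> completely_positive C.
Proof.
move=> [Cp C0] ij Cij0 cover.
pose Pi := (C i i)^-1 *: (col i C *m (col i C)^T).
pose Pj := (C j j)^-1 *: (col j C *m (col j C)^T).
pose S := schur_complement C i.
have Sp : positive_semidefinite S by exact: psd_schur_complement.
have Sj a : S a j = C a j.
  by rewrite schur_complementE (psd_symE j i Cp) Cij0 !mulr0 subr0.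
pose N := schur_complement S j.
have Np : positive_semidefinite N by exact: psd_schur_complement.
have CE : C = Pi + Pj + N.
  rewrite /N /schur_complement.
  have -> : col j S = col j C by apply/colP => a; rewrite [LHS]mxE Sj mxE.
  rewrite Sj -/Pj /S /schur_complement -/Pi.
  by rewrite -addrA [Pj + _]addrC subrK addrC subrK.
have Nj b : N j b = 0 by exact: schur_complement_pivot.
have Ni b : N i b = 0.
  rewrite /N schur_complementE /S (schur_complement_pivot _ _ Cp).
  by rewrite (schur_complement_pivot _ _ Cp) mul0r mulr0 subr0.
have suppN a b : a \notin [:: k; l] -> N a b = 0.
  have := cover a; rewrite !inE => /or4P[/eqP->|/eqP->|->|->]//.
  by rewrite orbT.
have Pi0 a b : 0 <= Pi a b.
  by rewrite !mxE big_ord1 !mxE !mulr_ge0 ?invr_ge0.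
have Pj0 a b : 0 <= Pj a b.
  by rewrite !mxE big_ord1 !mxE !mulr_ge0 ?invr_ge0.
have CPi : completely_positive Pi.
  apply: completely_positiveZ; first by rewrite invr_ge0.
  by apply: completely_positive_col => a; rewrite mxE.
have CPj : completely_positive Pj.
  apply: completely_positiveZ; first by rewrite invr_ge0.
  by apply: completely_positive_col => a; rewrite mxE.
have [kl0|kl0] := lerP 0 (N k l).
  rewrite CE; apply: completely_positiveD; first exact: completely_positiveD.
  exact: (@completely_positive_support2 _ _ _ k l).
pose u := Pi k l; pose w := Pj k l.
have uwN : 0 <= u + w + N k l.
  by have := C0 k l; rewrite {1}CE [(_ + N) _ _]mxE [(_ + Pj) _ _]mxE.
have uw : 0 < u + w by lra.
(* The share of [N] given to [Pi]; it makes [u + al * N k l] and its counterpart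
   for [Pj] proportional to [u + w + N k l]. *)
pose al := u / (u + w).
have al0 : 0 <= al by rewrite divr_ge0 ?Pi0// ltW.
have al1 : 0 <= 1 - al.
  by rewrite subr_ge0 ler_pdivrMr// mul1r lerDl Pj0.
have E1 : al * (u + w) = u by rewrite mulfVK// gt_eqF.
have -> : C = (Pi + al *: N) + (Pj + (1 - al) *: N).
  by rewrite [RHS]addrACA -scalerDl [al + _]addrC subrK scale1r -CE.
have Pp p b : (C p p)^-1 * (C b p * C p p) = C b p.
  have [e|e] := eqVneq (C p p) 0; last by field.
  have := psd_minor2 b p Cp; rewrite e mulr0 exprn_even_le0//= => /eqP->.
  by rewrite !mulr0.
have N_nonneg a b : 0 <= N a b \/ ((a = k /\ b = l) \/ (a = l /\ b = k)).
  have [ak|ak] := boolP (a \in [:: k; l]); last by left; rewrite suppN.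
  have [bk|bk] := boolP (b \in [:: k; l]); last first.
    by left; rewrite (psd_symE _ _ Np) suppN.
  move: ak bk; rewrite !inE => /orP[]/eqP-> /orP[]/eqP->; try tauto; left;
    exact: psd_diag_ge0.
have part p b : let P := (C p p)^-1 *: (col p C *m (col p C)^T) in
    0 <= b -> 0 <= P k l + b * N k l -> (forall c, N p c = 0) ->
    (forall a, a \notin [:: p; k; l] -> C a p = 0) ->
    completely_positive (P + b *: N).
  move=> P b0 kl Np0 Cp0.
  have PE c e : P c e = (C p p)^-1 * (C c p * C e p).
    by rewrite !mxE big_ord1 !mxE.
  have PC c : P p c = C c p by rewrite PE (mulrC (C p p)) Pp.
  have P0 a c : 0 <= P a c by rewrite PE !mulr_ge0 ?invr_ge0.
  apply: (@completely_positive_support3 _ _ _ p k l).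
  - apply: positive_semidefiniteD; last exact: positive_semidefiniteZ.
    apply: positive_semidefiniteZ; last exact: positive_semidefinite_col.
    by rewrite invr_ge0.
  - move=> a c; rewrite mxE [(b *: N) a c]mxE.
    have [Nac|[[-> ->]|[-> ->]]//] := N_nonneg a c.
      by rewrite addr_ge0 ?mulr_ge0.
    by rewrite (psd_symE l k Np) PE (mulrC (C l p)) -PE.
  - move=> a c ap; rewrite mxE [(b *: N) a c]mxE PE (Cp0 a)// mul0r mulr0 add0r.
    by rewrite suppN ?mulr0//; move: ap; rewrite !inE !negb_or => /andP[].
  - rewrite ![(P + _) _ _]mxE ![(b *: N) _ _]mxE !Np0 !mulr0 !addr0 !PC.
    have -> : C k p * C l p = P k l * C p p.
      have <- := Pp p l; rewrite PE; ring.
    by rewrite ler_wpM2r// gerDl mulr_ge0_le0// ltW.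
apply: completely_positiveD; apply: part => //.
- by rewrite -/u -[X in X + _]E1 -mulrDr mulr_ge0.
- move=> a; have := cover a; rewrite !inE.
  move=> /or4P[->//|/eqP-> _|->|->]; rewrite ?orbT//.
  by rewrite (psd_symE j i Cp).
- rewrite -/w; have -> : w = (1 - al) * (u + w) by rewrite mulrBl mul1r E1; ring.
  by rewrite -mulrDr mulr_ge0.
- move=> a; have := cover a; rewrite !inE.
  by move=> /or4P[/eqP-> _|->|->|->]; rewrite ?orbT.
Qed.

Lemma ord_cover4 d (i j : 'I_d) : (d <= 4)%N -> i != j ->
  exists k l, forall a, a \in [:: i; j; k; l].
Proof.
move=> d4 ij; set s := enum (predC (pred2 i j)).
have s2 : (size s <= 2)%N.
  have := cardC (pred2 i j); rewrite card2 ij card_ord /s -cardE => e.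
  by rewrite -(leq_add2l 2); apply: leq_trans d4; move: e => /= e; apply: eq_leq.
have cov a : [|| a == i, a == j | a \in s].
  by rewrite mem_enum !inE; case: (a == i); case: (a == j).
case: s s2 cov => [|k [|l [|//]]] _ cov.
- by exists i, i => a; have := cov a; rewrite !inE => /or3P[->|->|//]; rewrite ?orbT.
- by exists k, k => a; have := cov a; rewrite !inE => /or3P[->|->|->]; rewrite ?orbT.
- by exists k, l => a; have := cov a; rewrite !inE.
Qed.

(** If all the entries off the diagonal are positive, let [v] be the column of
    index [p] and subtract [t v v^T] with the largest [t] that keeps the entries
    off the diagonal non-negative.  The entries [(p, q)] impose [t <= 1 / C p p],
    so the result lies between [C] and its Schur complement at [p] and remains
    positive semidefinite; and it has a zero entry. *)
Lemma doubly_nonnegative_completely_positive (R : realType) d (C : 'M[R]_d) :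
  (d <= 4)%N -> doubly_nonnegative C -> completely_positive C.
Proof.
move=> d4 [Cp C0].
have [/existsP[[i j]/=/andP[ij /eqP Cij]]|] :=
    boolP [exists x : 'I_d * 'I_d, (x.1 != x.2) && (C x.1 x.2 == 0)].
  have [k [l cover]] := ord_cover4 d4 ij.
  exact: (completely_positive_zero_entry (conj Cp C0) ij Cij cover).
rewrite negb_exists => /forallP pos.
have {pos}offdiag i j : i != j -> 0 < C i j.
  move=> ij; rewrite lt_def C0 andbT.
  by have := pos (i, j); rewrite /= ij.
have [[p q] /= pq|noq] := pickP [pred x : 'I_d * 'I_d | x.1 != x.2]; last first.
  have [p _|nop] := pickP 'I_d; last first.
    have -> : C = 0 by apply/matrixP => i; have := nop i.
    exact: completely_positive0.
  have single a : a = p by have := noq (a, p) => /= /negbFE/eqP.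
  apply: (@completely_positive_support2 _ _ _ p p) => // a b.
  by rewrite (single a) inE eqxx.
have v0 i : 0 < C i p.
  have [->|ip] := eqVneq i p; last exact: offdiag.
  rewrite lt_def C0 andbT; apply/eqP => pp.
  have := psd_minor2 p q Cp; rewrite pp mul0r exprn_even_le0//= => /eqP pq0.
  by have := offdiag _ _ pq; rewrite pq0 ltxx.
(* The bound that the entry at [x] imposes on [t]. *)
pose f (x : 'I_d * 'I_d) := C x.1 x.2 / (C x.1 p * C x.2 p).
case: (@arg_minP _ _ _ (p, q) [pred x : 'I_d * 'I_d | x.1 != x.2] f pq).
move=> [i j] /= ij fmin; set t := f (i, j) in fmin.
have t0 : 0 <= t by rewrite divr_ge0// mulr_ge0// ltW.
pose C' := C - t *: (col p C *m (col p C)^T).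
have C'E a b : C' a b = C a b - t * (C a p * C b p).
  by rewrite !mxE big_ord1 !mxE.
have C'p : positive_semidefinite C'.
  have -> : C' = schur_complement C p +
      ((C p p)^-1 - t) *: (col p C *m (col p C)^T).
    by rewrite scalerBl addrA subrK.
  apply: positive_semidefiniteD; first exact: psd_schur_complement.
  apply: positive_semidefiniteZ; last exact: positive_semidefinite_col.
  rewrite subr_ge0; apply: (le_trans (fmin (p, q) pq)).
  rewrite /f /= (psd_symE p q Cp) le_eqVlt; apply/orP; left; apply/eqP.
  have h1 : C q p != 0 by rewrite gt_eqF.
  have h2 : C p p != 0 by rewrite gt_eqF.
  by field; rewrite h1 h2.
have C'0 a b : 0 <= C' a b.
  have [->|ab] := eqVneq a b; first exact: psd_diag_ge0.
  rewrite C'E subr_ge0 -ler_pdivlMr ?mulr_gt0//.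
  exact: (fmin (a, b)).
rewrite -[C](subrK (t *: (col p C *m (col p C)^T))) -/C'.
apply: completely_positiveD; last first.
  apply: completely_positiveZ => //.
  by apply: completely_positive_col => a; rewrite mxE.
have [k [l cover]] := ord_cover4 d4 ij.
apply: (completely_positive_zero_entry (conj C'p C'0) ij _ cover).
by rewrite C'E /t /f /= divfK ?subrr// mulf_neq0// gt_eqF.
Qed.

(** * The cone of completely positive matrices is closed *)

(** The matrices [b_j b_j^T] of the more than [d * d] columns [b_j] of [B] are
    linearly dependent.  Moving the weights of the [b_j b_j^T] along a linear
    relation until one of them vanishes makes a column superfluous. *)
Lemma caratheodory_step (R : realType) d k (B : 'M[R]_(d, k.+1)) :
  (d * d < k.+1)%N -> (forall i j, 0 <= B i j) ->
  exists B' : 'M[R]_(d, k), (forall i j, 0 <= B' i j) /\ B' *m B'^T = B *m B^T.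
Proof.
move=> dk B0.
pose G := \matrix_(j < k.+1) mxvec (col j B *m (col j B)^T).
have [c [c0 cG]] : exists c : 'rV[R]_k.+1, c != 0 /\ c *m G = 0.
  have : kermx G != 0.
    rewrite -mxrank_eq0 mxrank_ker subn_eq0 -ltnNge.
    exact: leq_ltn_trans (rank_leq_col G) dk.
  case/rowV0Pn => c /sub_kermxP cG c0; by exists c.
wlog [l cl] : c c0 cG / exists l, 0 < c 0 l.
  move=> H; have [|nopos] := pselect (exists l, 0 < c 0 l); first exact: H.
  apply: (H (- c)); rewrite ?oppr_eq0 ?mulNmx ?cG ?oppr0//.
  case/rV0Pn : c0 => l cl; exists l; rewrite mxE oppr_gt0 lt_neqAle cl /=.
  by rewrite leNgt; apply/negP => ?; apply: nopos; exists l.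
pose m := [arg max_(j > l) c 0 j]%O.
have cmax j : c 0 j <= c 0 m.
  by rewrite /m; case: arg_maxP => // i _ /(_ j); apply.
have cm : 0 < c 0 m by exact: lt_le_trans (cmax l).
(* The new weights: non-negative as [c 0 m] is the largest coefficient, and zero
   at [m]. *)
pose a j := 1 - c 0 j / c 0 m.
have a0 j : 0 <= a j by rewrite subr_ge0 ler_pdivrMr// mul1r.
have am : a m = 0 by rewrite /a divff ?subrr// gt_eqF.
pose B1 := \matrix_(i, j) (Num.sqrt (a j) * B i j).
exists (col' m B1); split => [i j|]; first by rewrite !mxE mulr_ge0// sqrtr_ge0.
apply/matrixP => i i'.
have rel : \sum_j c 0 j * (B i j * B i' j) = 0.
  have := congr1 (fun M : 'rV_(d * d) => M 0 (mxvec_index i i')) cG.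
  rewrite !mxE => e; rewrite -[RHS]e; apply: eq_bigr => j _.
  by rewrite mxE mxvecE !mxE big_ord1 !mxE.
transitivity (\sum_j a j * (B i j * B i' j)).
  rewrite (bigD1_ord m)//= am mul0r add0r mxE; apply: eq_bigr => j _.
  rewrite !mxE mulrACA -expr2 sqr_sqrtr//.
have -> : \sum_j a j * (B i j * B i' j) =
    \sum_j B i j * B i' j - (c 0 m)^-1 * \sum_j c 0 j * (B i j * B i' j).
  rewrite mulr_sumr -sumrB; apply: eq_bigr => j _; rewrite /a; ring.
by rewrite rel mulr0 subr0 mxE; apply: eq_bigr => j _; rewrite !mxE.
Qed.

Lemma completely_positive_caratheodory (R : realType) d (C : 'M[R]_d) :
  completely_positive C ->
  exists B : 'M[R]_(d, d * d), (forall i j, 0 <= B i j) /\ C = B *m B^T.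
Proof.
move=> [k [B [B0 CB]]].
have {B B0 CB} : exists k (B : 'M[R]_(d, k)),
    [/\ (k <= d * d)%N, forall i j, 0 <= B i j & C = B *m B^T].
  elim: k => [|k IH] in B B0 CB *; first by exists 0%N, B.
  have [dk|dk] := ltnP (d * d) k.+1; last by exists k.+1, B.
  have [B' [B'0 B'B]] := caratheodory_step dk B0.
  by apply: (IH B') => //; rewrite B'B.
move=> [l [B [/subnKC le B0 CB]]]; rewrite -le.
exists (row_mx B 0); split; last by rewrite tr_row_mx mul_row_col mul0mx addr0.
by move=> i j; rewrite mxE; case: (fintype.split j) => a//; rewrite mxE.
Qed.

Lemma ultrafilter_fmap (T U : Type) (f : T -> U) (F : set_system T) :
  UltraFilter F -> UltraFilter (f @ F).
Proof.
move=> UF; split; first exact: fmap_proper_filter.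
move=> G PG FG; apply/seteqP; split=> // A GA.
rewrite /fmap /=.
have [//|nA] := in_ultra_setVsetC (f @^-1` A) UF.
have GnA : G (~` A) by apply: FG.
by have := filter_ex (filterI GA GnA) => -[x [? ?]].
Qed.

(** Factors [B n] of a fixed size exist by [completely_positive_caratheodory], and
    their entries are bounded since [(B n i l)^2 <= Cn n i i].  All of them
    therefore converge along one ultrafilter finer than that of large [n]. *)
Lemma completely_positive_closed (R : realType) d (C : 'M[R]_d)
    (Cn : nat -> 'M[R]_d) :
  (forall n, completely_positive (Cn n)) ->
  (forall i j, Cn n i j @[n --> \oo] --> C i j) ->
  completely_positive C.
Proof.
move=> CPn CnC.
have /choice[B] : forall n, exists B : 'M[R]_(d, d * d),
    (forall i j, 0 <= B i j) /\ Cn n = B *m B^T.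
  by move=> n; exact: completely_positive_caratheodory.
move=> BE.
have [U [UU ooU]] := ultraFilterLemma (eventually_filter).
have PU : ProperFilter U by exact: ultra_proper.
have Blim i l : exists b : R, B n i l @[n --> U] --> b.
  have UB := ultrafilter_fmap (fun n => B n i l) UU.
  have := @segment_compact R 0 (Num.sqrt (C i i + 1)).
  rewrite compact_ultra => /(_ _ UB)[|b [_ Bb]]; last by exists b.
  apply: ooU; have := CnC i i => /cvgr_le /(_ (C i i + 1)).
  move=> /(_ _)[|N _ HN]; first by rewrite ltrDl.
  exists N => // n /= /HN Cn1; rewrite /= in_itv /=.
  have [B0 CB] := BE n; rewrite B0 /= -[X in X <= _]ger0_norm// -sqrtr_sqr.
  rewrite ler_wsqrtr//; apply: le_trans Cn1.
  rewrite CB mxE (bigD1 l)//= mxE -expr2 lerDl sumr_ge0// => a _.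
  by rewrite mxE mulr_ge0.
have /choice[b bE] : forall x : 'I_d * 'I_(d * d), exists b : R,
    B n x.1 x.2 @[n --> U] --> b by move=> [i l]; exact: Blim.
exists (d * d)%N, (\matrix_(i, l) b (i, l)); split.
  move=> i l; rewrite mxE.
  apply: (closed_cvg (fun x : R => 0 <= x) _ _ _ (bE (i, l))).
  - exact: closed_ge.
  - by apply: filterE => n /=; exact: (BE n).1.
apply/matrixP => i j.
have e1 : Cn n i j @[n --> U] --> C i j.
  by move=> A /(CnC i j) ?; exact: ooU.
have e2 : Cn n i j @[n --> U] --> (\sum_l b (i, l) * b (j, l)).
  have -> : (fun n => Cn n i j) = (fun n => \sum_l B n i l * B n j l).
    apply/funext => n; rewrite (BE n).2 mxE; apply: eq_bigr => l _.
    by rewrite mxE.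
  apply: (@cvg_big _ _ +%R) => [|l _]; first exact: add_continuous.
  apply: cvgM; [exact: (bE (i, l))|exact: (bE (j, l))].
rewrite (cvg_unique (@Rhausdorff R) e1 e2) mxE.
by apply: eq_bigr => l _; rewrite !mxE.
Qed.

(** * Second moments of non-negative random vectors *)

(** Product rule on rectangles, restated so that Fubini's theorem applies. *)
Lemma joint_law_product d d1 d2 (T : measurableType d) (T1 : measurableType d1)
    (T2 : measurableType d2) (R : realType) (P : probability T R)
    (mu1 : probability T1 R) (mu2 : probability T2 R) (X : T -> T1) (Y : T -> T2) :
  measurable_fun setT X -> measurable_fun setT Y ->
  (forall A B, measurable A -> measurable B ->
     P (X @^-1` A `&` Y @^-1` B) = (mu1 A * mu2 B)%E) ->
  forall M, measurable M -> P [set w | M (X w, Y w)] = (mu1 \x mu2)%E M.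
Proof.
move=> mX mY XY M mM.
have mXY : measurable_fun setT (fun w => (X w, Y w)).
  exact/measurable_fun_pair.
pose Z : {mfun T >-> (T1 * T2)%type} :=
  HB.pack (fun w => (X w, Y w)) (isMeasurableFun.Build _ _ _ _ _ mXY).
rewrite (@product_measure_unique _ _ _ _ _ _ _ (distribution P Z))//.
Qed.

Lemma independent_expectationM d (T : measurableType d) (R : realType)
    (P : probability T R) (X Y : T -> R) :
  measurable_fun setT X -> measurable_fun setT Y ->
  (forall w, 0 <= X w) -> (forall w, 0 <= Y w) ->
  (forall A B, measurable A -> measurable B ->
     P (X @^-1` A `&` Y @^-1` B) = (P (X @^-1` A) * P (Y @^-1` B))%E) ->
  (\int[P]_w (X w * Y w)%:E = (\int[P]_w (X w)%:E) * (\int[P]_w (Y w)%:E))%E.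
Proof.
move=> mX mY X0 Y0 XY.
pose X' : {mfun T >-> R} := HB.pack X (isMeasurableFun.Build _ _ _ _ _ mX).
pose Y' : {mfun T >-> R} := HB.pack Y (isMeasurableFun.Build _ _ _ _ _ mY).
have mXY : measurable_fun setT (fun w => (X w, Y w)).
  exact/measurable_fun_pair.
pose Z : {mfun T >-> (R * R)%type} :=
  HB.pack (fun w => (X w, Y w)) (isMeasurableFun.Build _ _ _ _ _ mXY).
pose f (z : R * R) : \bar R := (`|z.1| * `|z.2|)%:E.
have mf : measurable_fun [set: (R * R)%type] f.
  apply/measurable_EFinP; apply: measurable_funM.
    by apply: measurableT_comp.
  by apply: measurableT_comp.
have f0 z : (0 <= f z)%E by rewrite lee_fin mulr_ge0.
transitivity (\int[P]_w f (X w, Y w))%E.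
  by apply: eq_integral => w _; rewrite /f /= !ger0_norm.
rewrite -(@ge0_integral_distribution _ _ _ _ _ P Z f)//.
transitivity (\int[distribution P X' \x distribution P Y']_z f z)%E.
  apply: eq_measure_integral => M mM _.
  exact: (@joint_law_product _ _ _ _ _ _ _ P (distribution P X') (distribution P Y')).
rewrite fubini_tonelli1//.
have -> : (\int[P]_w (X w)%:E = \int[distribution P X']_x `|x|%:E)%E.
  rewrite ge0_integral_distribution//.
  - by apply: eq_integral => w _; rewrite /= ger0_norm.
  - by apply/measurable_EFinP.
have -> : (\int[P]_w (Y w)%:E = \int[distribution P Y']_x `|x|%:E)%E.
  rewrite ge0_integral_distribution//.
  - by apply: eq_integral => w _; rewrite /= ger0_norm.
  - by apply/measurable_EFinP.
set b := (\int[distribution P Y']_x `|x|%:E)%E.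
rewrite -ge0_integralZr//; last 2 first.
- by apply/measurable_EFinP.
- by apply: integral_ge0 => x _; rewrite lee_fin.
apply: eq_integral => x _; rewrite /fubini_F /f /=.
under eq_integral do rewrite EFinM.
rewrite ge0_integralZl//; last by apply/measurable_EFinP.
Qed.

Lemma same_law_expectation d (T : measurableType d) (R : realType)
    (P : probability T R) (X Y : T -> R) :
  measurable_fun setT X -> measurable_fun setT Y ->
  (forall w, 0 <= X w) -> (forall w, 0 <= Y w) ->
  (forall A, measurable A -> P (X @^-1` A) = P (Y @^-1` A)) ->
  (\int[P]_w (X w)%:E = \int[P]_w (Y w)%:E)%E.
Proof.
move=> mX mY X0 Y0 XY.
pose X' : {mfun T >-> R} := HB.pack X (isMeasurableFun.Build _ _ _ _ _ mX).
pose Y' : {mfun T >-> R} := HB.pack Y (isMeasurableFun.Build _ _ _ _ _ mY).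
have -> : (\int[P]_w (X w)%:E = \int[distribution P X']_x `|x|%:E)%E.
  rewrite ge0_integral_distribution//.
  - by apply: eq_integral => w _; rewrite /= ger0_norm.
  - by apply/measurable_EFinP.
have -> : (\int[P]_w (Y w)%:E = \int[distribution P Y']_x `|x|%:E)%E.
  rewrite ge0_integral_distribution//.
  - by apply: eq_integral => w _; rewrite /= ger0_norm.
  - by apply/measurable_EFinP.
by apply: eq_measure_integral => A mA _; exact: XY.
Qed.

(** Rounding down to the grid of mesh [1 / n.+1], with values at most [n.+1]: a
    bounded range makes the number of values finite. *)
Definition grid_index (R : realType) (n : nat) (x : R) : nat :=
  minn (Num.truncn (n.+1%:R * x)) (n.+1 * n.+1).

Lemma le_grid_index (R : realType) n (x y : R) :
  x <= y -> (grid_index n x <= grid_index n y)%N.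
Proof.
move=> xy; rewrite /grid_index leq_min !geq_min leqnn orbT andbT.
by rewrite le_truncn// ler_wpM2l.
Qed.

Lemma measurable_grid_index (R : realType) n k :
  measurable [set x : R | grid_index n x = k].
Proof.
apply: is_interval_measurable => x y /= xk yk z /andP[xz zy].
apply/eqP; rewrite eqn_leq -{1}yk -{1}xk.
by rewrite !le_grid_index.
Qed.

Lemma grid_index_le (R : realType) n (x : R) : 0 <= x ->
  (grid_index n x)%:R / n.+1%:R <= x.
Proof.
move=> x0; rewrite ler_pdivrMr ?ltr0n// mulrC.
apply: (@le_trans _ _ (Num.truncn (n.+1%:R * x))%:R).
  by rewrite ler_nat geq_minl.
by rewrite truncn_le mulr_ge0.
Qed.

Lemma grid_index_cvg (R : realType) (x : R) : 0 <= x ->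
  (grid_index n x)%:R / n.+1%:R @[n --> \oo] --> x.
Proof.
move=> x0.
have lo : x - n.+1%:R^-1 @[n --> \oo] --> x.
  rewrite -[X in _ --> X]subr0; apply: cvgB; first exact: cvg_cst.
  exact: cvg_harmonic.
apply: (squeeze_cvgr _ lo (cvg_cst x)).
near=> n; rewrite grid_index_le// andbT.
have n0 : 0 < n.+1%:R :> R by rewrite ltr0n.
have xn : x <= n.+1%:R.
  have : (Num.truncn x < n.+1)%N.
    by near: n; exists (Num.truncn x).
  by rewrite truncn_lt_nat// => /ltW.
rewrite ler_pdivlMr// mulrBl mulVf ?gt_eqF// lerBlDr /grid_index.
have /minn_idPl -> : (Num.truncn (n.+1%:R * x) <= n.+1 * n.+1)%N.
  rewrite truncn_le_nat; apply: (@le_lt_trans _ _ (n.+1 * n.+1)%:R).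
    by rewrite natrM ler_wpM2l.
  by rewrite ltr_nat.
by rewrite mulrC natr1 ltW// truncnS_gt.
Unshelve. all: by end_near. Qed.

(** After rounding, the vector takes finitely many values [v phi], on the events
    [A phi], and its matrix of second moments is the sum of the matrices
    [P (A phi) (v phi) (v phi)^T].  Rounding errors vanish by dominated
    convergence, the cone being closed. *)
Lemma completely_positive_second_moment d0 (T : measurableType d0)
    (R : realType) (P : probability T R) d (X : 'I_d -> T -> R) :
  (forall i, measurable_fun setT (X i)) -> (forall i w, 0 <= X i w) ->
  (forall i j, P.-integrable setT (fun w => (X i w * X j w)%:E)) ->
  completely_positive (\matrix_(i, j) fine (\int[P]_w (X i w * X j w)%:E)%E).
Proof.
move=> mX X0 iX.
pose Y n i w : R := (grid_index n (X i w))%:R / n.+1%:R.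
have Y0 n i w : 0 <= Y n i w by rewrite divr_ge0.
pose F n := {ffun 'I_d -> 'I_(n.+1 * n.+1).+1}.
pose A n (phi : F n) : set T :=
  \bigcap_(i in setT) [set w | grid_index n (X i w) = phi i].
have mA n phi : measurable (@A n phi).
  apply: fin_bigcap_measurable => // i _.
  rewrite -[X in measurable X]setTI.
  exact: (mX i measurableT _ (measurable_grid_index n (phi i))).
pose v n (phi : F n) : 'cV[R]_d := \col_i ((phi i)%:R / n.+1%:R).
have v0 n phi i : 0 <= @v n phi i 0 by rewrite mxE divr_ge0.
have YE n i j w : Y n i w * Y n j w =
    \sum_phi (@v n phi i 0 * @v n phi j 0) * \1_(@A n phi) w.
  pose phi0 : F n := [ffun i => inord (grid_index n (X i w))].
  have phi0E k : phi0 k = grid_index n (X k w) :> nat.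
    by rewrite ffunE inordK// ltnS geq_minr.
  rewrite (bigD1 phi0)//= big1 ?addr0 => [|phi phiN].
    by rewrite !mxE !phi0E indicE mem_set ?mulr1// => k _ /=; rewrite phi0E.
  rewrite indicE memNset ?mulr0// => Aphi; move/eqP: phiN; apply.
  by apply/ffunP => k; apply/val_inj; rewrite /= phi0E (Aphi k I).
pose C n := \sum_phi fine (P (@A n phi)) *: (@v n phi *m (@v n phi)^T).
apply: (@completely_positive_closed _ _ _ C).
  move=> n; apply: completely_positive_sum => phi.
  apply: completely_positiveZ; first by rewrite fine_ge0.
  exact: completely_positive_col.
move=> i j; rewrite mxE.
have CE n : ((C n i j)%:E = \int[P]_w (Y n i w * Y n j w)%:E)%E.
  under eq_integral do rewrite YE -sumEFin.
  rewrite ge0_integral_sum//; last 2 first.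
  - move=> phi; apply/measurable_EFinP; apply: measurable_funM => //.
  - by move=> phi w _; rewrite lee_fin !mulr_ge0.
  rewrite /C summxE -sumEFin; apply: eq_bigr => phi _.
  under eq_integral do rewrite EFinM.
  rewrite ge0_integralZl//; last 2 first.
  - by apply/measurable_EFinP.
  - by rewrite lee_fin mulr_ge0.
  rewrite integral_indic// setIT !mxE big_ord1 !mxE EFinM fineK ?fin_num_measure//.
  by rewrite muleC.
have mY n k : measurable_fun setT (Y n k).
  apply: measurable_funM => //.
  have mg : measurable_fun setT (fun x : R => (grid_index n x)%:R : R).
    apply: nondecreasing_measurable => // x y xy.
    by rewrite ler_nat le_grid_index.
  exact: (measurableT_comp mg (mX k)).
have [|||||_ _] := @dominated_convergence _ _ _ P setT measurableT
  (fun n w => (Y n i w * Y n j w)%:E) (fun w => (X i w * X j w)%:E)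
  (fun w => (X i w * X j w)%:E).
- by move=> n; apply/measurable_EFinP; exact: measurable_funM.
- by apply/measurable_EFinP; exact: measurable_funM.
- apply: aeW => w _; apply: cvg_EFin; first exact: nearW.
  by apply: cvgM; exact: grid_index_cvg.
- exact: iX.
- apply: aeW => w n _; rewrite gee0_abs ?lee_fin ?mulr_ge0//.
  by rewrite ler_pM// grid_index_le.
under [X in X @ _]eq_fun do rewrite -CE.
rewrite -[X in _ --> X]fineK ?integrable_fin_num//.
move=> /fine_cvg; exact.
Qed.

(** * The covariance matrix of a subordinator *)

Lemma borel_preimage (R : realType) d (f : 'cV[R]_d -> R) (A : set R) :
  continuous f -> measurable A -> borel (f @^-1` A).
Proof.
move=> cf mA; pose V := g_sigma_algebraType (@open 'cV[R]_d).
have mf : measurable_fun [set: V] (f : V -> R).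
  apply: (measurability (@RGenOInfty.G R)); first exact: RGenOInfty.measurableE.
  move=> _ [_ [r ->] <-]; rewrite setTI.
  apply: sub_sigma_algebra; apply: open_comp => //.
by have := mf measurableT A mA; rewrite setTI.
Qed.

Lemma measurable_random_vector disp (T : measurableType disp) (R : realType) d
    (X : T -> 'cV[R]_d) (f : 'cV[R]_d -> R) :
  random_vector X -> continuous f -> measurable_fun setT (f \o X).
Proof.
move=> rX cf _ A mA; rewrite setTI; apply: (rX (f @^-1` A)).
exact: borel_preimage.
Qed.

Section increments.
Context (disp : measure_display) (T : measurableType disp) (R : realType)
  (P : probability T R) (d : nat) (L : R -> T -> 'cV[R]_d).
Context (Lsub : multivariate_subordinator P L).

(** Increments of a subordinator are non-negative only almost surely; taking the
    absolute value makes them non-negative everywhere without changing their law. *)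
Definition increment s t i w := `|L t w i 0 - L s w i 0|.

Lemma measurable_increment s t i : 0 <= s -> 0 <= t ->
  measurable_fun setT (increment s t i).
Proof.
move=> s0 t0; apply: measurableT_comp => //.
have mc u : 0 <= u -> measurable_fun setT (fun w => L u w i 0).
  move=> u0; case: Lsub => -[mL _ _ _ _] _.
  by apply: (@measurable_random_vector _ _ _ _ (L u) (fun v => v i 0)); [exact: mL|
    exact: coord_continuous].
by apply: measurable_funB; exact: mc.
Qed.

Lemma increment_ge0 s t i w : 0 <= increment s t i w.
Proof. exact: normr_ge0. Qed.

Definition mean h i := (\int[P]_w (increment 0 h i w)%:E)%E.
Definition moment h i j :=
  (\int[P]_w (increment 0 h i w * increment 0 h j w)%:E)%E.

Lemma increment_add h i : 0 <= h -> \forall w \ae P,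
  increment 0 (h + h) i w = increment 0 h i w + increment h (h + h) i w.
Proof.
move=> h0; case: Lsub => _ /(_ i)[_]; apply: filterS => w Lw.
have h01 := Lw 0 h (lexx 0) h0.
have h12 : L h w i 0 <= L (h + h) w i 0 by apply: Lw; rewrite ?lerDl.
rewrite /increment !ger0_norm ?subr_ge0//; last exact: le_trans h12.
by rewrite [RHS]addrC subrKA.
Qed.

Let cont_norm i : continuous (fun v : 'cV[R]_d => `|v i 0|).
Proof.
move=> v; exact: (continuous_comp (@coord_continuous R d 1 i 0 v) (@norm_continuous _ R^o _)).
Qed.

Lemma increment_same_mean h i : 0 <= h ->
  (\int[P]_w (increment h (h + h) i w)%:E = mean h i)%E.
Proof.
move=> h0; have hh0 : 0 <= h + h by rewrite addr_ge0.
apply: same_law_expectation.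
- exact: measurable_increment.
- exact: measurable_increment.
- by move=> w; exact: increment_ge0.
- by move=> w; exact: increment_ge0.
move=> A mA; case: Lsub => -[_ _ [_ stat] _ _] _.
have := stat h h h0 h0 _ (borel_preimage (@cont_norm i) mA).
have E u v : (fun w => L v w - L u w) @^-1` ((fun x => `|x i 0|) @^-1` A) =
    increment u v i @^-1` A.
  by apply/seteqP; split=> w; rewrite /= /increment !mxE.
by rewrite !E.
Qed.

Lemma increment_same_moment h i j : 0 <= h ->
  (\int[P]_w (increment h (h + h) i w * increment h (h + h) j w)%:E =
   moment h i j)%E.
Proof.
move=> h0; have hh0 : 0 <= h + h by rewrite addr_ge0.
apply: same_law_expectation.
- by apply: measurable_funM; exact: measurable_increment.
- by apply: measurable_funM; exact: measurable_increment.
- by move=> w; rewrite mulr_ge0 ?increment_ge0.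
- by move=> w; rewrite mulr_ge0 ?increment_ge0.
move=> A mA; case: Lsub => -[_ _ [_ stat] _ _] _.
have cf : continuous (fun v : 'cV[R]_d => `|v i 0| * `|v j 0|).
  by move=> v; exact: (cvgM (@cont_norm i v) (@cont_norm j v)).
have := stat h h h0 h0 _ (borel_preimage cf mA).
have E u v : (fun w => L v w - L u w) @^-1`
      ((fun x => `|x i 0| * `|x j 0|) @^-1` A) =
    (fun w => increment u v i w * increment u v j w) @^-1` A.
  by apply/seteqP; split=> w; rewrite /= /increment !mxE.
by rewrite !E.
Qed.

Lemma increment_independent h i j : 0 < h ->
  (\int[P]_w (increment 0 h i w * increment h (h + h) j w)%:E =
   mean h i * mean h j)%E.
Proof.
move=> h0; have hh0 : 0 <= h + h by rewrite addr_ge0// ltW.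
rewrite -(increment_same_mean j (ltW h0)).
apply: independent_expectationM.
- exact: measurable_increment (ltW h0).
- exact: measurable_increment (ltW h0) hh0.
- by move=> w; exact: increment_ge0.
- by move=> w; exact: increment_ge0.
move=> A B mA mB; case: Lsub => -[_ _ [ind _] _ _] _.
pose t k := [:: 0; h; h + h]`_k.
have t_lt k : (k < 2)%N -> t k < t k.+1.
  by case: k => [|[|//]] _; rewrite /t /= ?ltrDl.
pose S k := if k is 0%N then (fun v : 'cV[R]_d => `|v i 0|) @^-1` A
  else (fun v : 'cV[R]_d => `|v j 0|) @^-1` B.
have S_borel k : (k < 2)%N -> borel (S k).
  by move=> _; case: k => [|k]; exact: borel_preimage.
have := ind 2%N t (lexx 0) t_lt S S_borel.
rewrite big_ord_recl big_ord1 /= bigcap_mkord big_ord_recl big_ord1 /t /S /=.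
have E u v k (D : set R) : [set w | D `|(L v w - L u w) k 0|] = increment u v k @^-1` D.
  by apply/seteqP; split=> w; rewrite /= /increment !mxE.
by rewrite /preimage /= !E.
Qed.

Lemma mean_double h i : 0 < h -> (mean (h + h) i = mean h i + mean h i)%E.
Proof.
move=> h0; have hh0 : 0 <= h + h by rewrite addr_ge0// ltW.
have h0' := ltW h0.
rewrite -{2}(increment_same_mean i h0') -ge0_integralD//; last 4 first.
- by move=> w _; rewrite lee_fin increment_ge0.
- by apply/measurable_EFinP; exact: measurable_increment.
- by move=> w _; rewrite lee_fin increment_ge0.
- by apply/measurable_EFinP; exact: measurable_increment.
apply: ae_eq_integral => //.
- by apply/measurable_EFinP; exact: measurable_increment.
- by apply: emeasurable_funD; apply/measurable_EFinP; exact: measurable_increment.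
apply: filterS (increment_add i h0') => w e _.
by rewrite e EFinD.
Qed.

(** The cross terms factorize by independence and the two other terms coincide by
    stationarity. *)
Lemma moment_double h i j : 0 < h -> (moment (h + h) i j =
  moment h i j + mean h i * mean h j + (mean h j * mean h i + moment h i j))%E.
Proof.
move=> h0; have hh0 : 0 <= h + h by rewrite addr_ge0// ltW.
have h0' := ltW h0.
pose X := increment 0 h; pose Y := increment h (h + h).
have mX k : measurable_fun setT (X k) by exact: measurable_increment.
have mY k : measurable_fun setT (Y k) by exact: measurable_increment.
have X0 k w : 0 <= X k w by exact: increment_ge0.
have Y0 k w : 0 <= Y k w by exact: increment_ge0.
have mM (f g : T -> R) : measurable_fun setT f -> measurable_fun setT g ->
    measurable_fun setT (fun w => (f w * g w)%:E).
  by move=> mf mg; apply/measurable_EFinP; exact: measurable_funM.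
rewrite -[in X in (_ + X)%E](increment_same_moment i j h0').
rewrite -(increment_independent i j h0) -(increment_independent j i h0).
rewrite /moment -/X -/Y.
rewrite -!ge0_integralD//=; last first.
all: try by move=> *; rewrite ?adde_ge0 ?lee_fin ?mulr_ge0.
all: try by repeat apply: emeasurable_funD; exact: mM.
apply: ae_eq_integral => //.
- by apply: mM; exact: measurable_increment.
- by repeat apply: emeasurable_funD; exact: mM.
apply: filterS2 (increment_add i h0') (increment_add j h0') => w ei ej _.
rewrite ei ej -!EFinD; congr EFin; rewrite /X /Y; ring.
Qed.

Lemma mean_ge0 h i : (0 <= mean h i)%E.
Proof. by apply: integral_ge0 => w _; rewrite lee_fin increment_ge0. Qed.

Lemma moment_ge0 h i j : (0 <= moment h i j)%E.
Proof.
by apply: integral_ge0 => w _; rewrite lee_fin mulr_ge0 ?increment_ge0.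
Qed.

(** Halving [h] divides the mean and the covariance by 2, whereas the product of
    means in the covariance is divided by 4: it becomes negligible as [h] tends to 0. *)
Lemma dyadic_scaling n i j :
  (forall i, mean 1 i < +oo)%E -> (forall i j, moment 1 i j < +oo)%E ->
  let h := 2^-1 ^+ n in
  [/\ (forall i, mean h i < +oo)%E, (forall i j, moment h i j < +oo)%E,
      fine (mean 1 i) = 2 ^+ n * fine (mean h i) &
      fine (moment 1 i j) - fine (mean 1 i) * fine (mean 1 j) =
      2 ^+ n * (fine (moment h i j) - fine (mean h i) * fine (mean h j))].
Proof.
move=> m1 M1; elim: n i j => [|n IH] i j h; first by split=> //; rewrite !mul1r.
set h' := 2^-1 ^+ n in IH.
have h0 : 0 < h by rewrite exprn_gt0// invr_gt0.
have hh : h + h = h' by rewrite /h exprS -/h'; lra.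
have [mf Mf e1 e2] := IH i j; rewrite -hh in mf Mf e1 e2.
have mh k : (mean h k < +oo)%E.
  by apply: le_lt_trans (mf k); rewrite mean_double// leeDl// mean_ge0.
have Mh k l : (moment h k l < +oo)%E.
  apply: le_lt_trans (Mf k l); rewrite moment_double// -addeA leeDl//.
  by rewrite adde_ge0 ?mule_ge0 ?mean_ge0// adde_ge0 ?mule_ge0 ?mean_ge0 ?moment_ge0.
have mfin k : mean h k \is a fin_num by rewrite ge0_fin_numE ?mean_ge0.
have Mfin k l : moment h k l \is a fin_num by rewrite ge0_fin_numE ?moment_ge0.
have md k : fine (mean (h + h) k) = fine (mean h k) + fine (mean h k).
  by rewrite mean_double// fineD.
split=> //.
- by rewrite e1 md exprS; ring.
- have fineE (x a b : \bar R) :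
      x \is a fin_num -> a \is a fin_num -> b \is a fin_num ->
      fine (x + a * b + (b * a + x))%E =
      fine x + fine a * fine b + (fine b * fine a + fine x).
    by case: x a b => [x| |] [a| |] [b| |].
  rewrite e2 !md moment_double// fineE// exprS; ring.
Qed.

Lemma moment_completely_positive h : 0 <= h ->
  (forall i j, moment h i j < +oo)%E ->
  completely_positive (\matrix_(i, j) fine (moment h i j)).
Proof.
move=> h0 Mh; apply: completely_positive_second_moment.
- by move=> i; exact: measurable_increment.
- by move=> i w; exact: increment_ge0.
move=> i j; apply/integrableP; split.
  by apply/measurable_EFinP; apply: measurable_funM; exact: measurable_increment.
rewrite (le_lt_trans _ (Mh i j))// ge0_le_integral//.
- by apply: measurableT_comp => //; apply/measurable_EFinP; apply: measurable_funM;
    exact: measurable_increment.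
- by apply/measurable_EFinP; apply: measurable_funM; exact: measurable_increment.
- by move=> w _; rewrite gee0_abs// lee_fin mulr_ge0 ?increment_ge0.
Qed.

Lemma completely_positive_variance :
  (forall i, mean 1 i < +oo)%E -> (forall i j, moment 1 i j < +oo)%E ->
  completely_positive
    (\matrix_(i, j) (fine (moment 1 i j) - fine (mean 1 i) * fine (mean 1 j))).
Proof.
move=> m1 M1.
pose h n : R := 2^-1 ^+ n.
pose C n : 'M[R]_d := 2 ^+ n *: \matrix_(i, j) fine (moment (h n) i j).
have h0 n : 0 <= h n by rewrite exprn_ge0.
apply: (@completely_positive_closed _ _ _ C).
  move=> n; apply: completely_positiveZ; first by rewrite exprn_ge0.
  apply: moment_completely_positive => // i j.
  by have [] := dyadic_scaling n i j m1 M1.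
move=> i j; rewrite mxE.
have -> : (fun n => C n i j) = (fun n =>
    fine (moment 1 i j) - fine (mean 1 i) * fine (mean 1 j) +
    h n * (fine (mean 1 i) * fine (mean 1 j))).
  apply/funext => n; have [_ _ ei e] := dyadic_scaling n i j m1 M1.
  have [_ _ ej _] := dyadic_scaling n j i m1 M1.
  rewrite e ei ej !mxE -/(h n).
  have : h n * 2 ^+ n = 1 by rewrite -exprMn mulVf ?expr1n.
  set x := h n; set y := 2 ^+ n => xy.
  set a := fine (mean x i); set b := fine (mean x j).
  have -> : x * (y * a * (y * b)) = (x * y) * y * a * b by ring.
  rewrite xy; ring.
rewrite -[X in _ --> X]addr0; apply: cvgD; first exact: cvg_cst.
rewrite -[X in _ --> X](mul0r (fine (mean 1 i) * fine (mean 1 j))).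
apply: cvgM; last exact: cvg_cst.
by apply: cvg_expr; rewrite ger0_norm// invf_lt1// ltr1n.
Qed.

End increments.

Theorem var_subordinator_completely_positive (disp : measure_display)
    (T : measurableType disp) (R : realType) (P : probability T R) (d : nat)
    (L : R -> T -> 'cV[R]_d) :
  multivariate_subordinator P L -> finite_second_moments P (L 1) ->
  completely_positive (var P (L 1)).
Proof.
move=> Lsub L2.
have L1 i : (fun w => L 1 w i 0) \in Lfun P 1.
  by apply: Lfun_subset12 (L2 i); rewrite fin_num_measure.
have inc i : \forall w \ae P, increment L 0 1 i w = L 1 w i 0.
  case: Lsub => -[_ L0 _ _ _] /(_ i)[_]; apply: filterS2 L0 => w L0 Lw.
  by rewrite /increment ger0_norm ?subr_ge0 ?Lw// L0 mxE subr0.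
have mL i : measurable_fun setT (fun w => L 1 w i 0).
  by have /Lfun1_integrable/measurable_int/measurable_EFinP := L1 i.
have m1 i : mean P L 1 i = (\int[P]_w (L 1 w i 0)%:E)%E.
  apply: ae_eq_integral => //.
  - by apply/measurable_EFinP; exact: (measurable_increment Lsub).
  - by apply/measurable_EFinP.
  by apply: filterS (inc i) => w e _; rewrite e.
have M1 i j : moment P L 1 i j = (\int[P]_w (L 1 w i 0 * L 1 w j 0)%:E)%E.
  apply: ae_eq_integral => //.
  - by apply/measurable_EFinP; apply: measurable_funM; exact: (measurable_increment Lsub).
  - by apply/measurable_EFinP; exact: measurable_funM.
  by apply: filterS2 (inc i) (inc j) => w ei ej _; rewrite ei ej.
have LL i j := Lfun2_mul_Lfun1 (L2 i) (L2 j).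
have -> : var P (L 1) = \matrix_(i, j)
    (fine (moment P L 1 i j) - fine (mean P L 1 i) * fine (mean P L 1 j)).
  apply/matrixP => i j; rewrite !mxE (covarianceE (L1 i) (L1 j) (LL i j)).
  rewrite fineB ?fineM ?fin_numM ?expectation_fin_num//; last exact: LL.
  by rewrite !m1 M1 !unlock.
apply: completely_positive_variance => // [i|i j].
- have /Lfun1_integrable iL := L1 i.
  by rewrite m1 -ge0_fin_numE -?m1 ?mean_ge0// m1; exact: integrable_fin_num.
- have /Lfun1_integrable iL := LL i j.
  by rewrite M1 -ge0_fin_numE -?M1 ?moment_ge0// M1; exact: integrable_fin_num.
Qed.

(** * A uniform variable split into two independent ones *)

Definition bits := nat -> bool.

Definition cylinder (n : nat) (w : bits) : set bits :=
  [set b | forall i, (i < n)%N -> b i = w i].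

(** The empty set is included to have a family closed under intersection. *)
Definition cylinders : set (set bits) :=
  [set A | A = set0 \/ exists n w, A = cylinder n w].

Definition coin_space := g_sigma_algebraType cylinders.

Lemma cylinder_mem n (w b : bits) : cylinder n w b -> cylinder n w = cylinder n b.
Proof.
by move=> wb; apply/seteqP; split=> c h i ni; rewrite h// wb.
Qed.

Lemma setI_closed_cylinders : setI_closed cylinders.
Proof.
move=> A B [->|[n [w ->]]]; first by rewrite set0I; left.
move=> [->|[m [v ->]]]; first by rewrite setI0; left.
have [[b [wb vb]]|/forallNP nb] :=
    pselect (exists b, cylinder n w b /\ cylinder m v b); last first.
  by left; rewrite -subset0 => b; exact: nb.
right; exists (maxn n m), b; rewrite (cylinder_mem wb) (cylinder_mem vb).
apply/seteqP; split=> c.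
  move=> [cn cm] i; rewrite leq_max => /orP[|]; [exact: cn|exact: cm].
by move=> h; split=> i ilt; apply: h; rewrite leq_max ilt ?orbT.
Qed.

Lemma measurable_cylinder n w : measurable (cylinder n w : set coin_space).
Proof. by apply: sub_sigma_algebra; right; exists n, w. Qed.

Fixpoint prefix_value (n : nat) (b : bits) : nat :=
  if n is k.+1 then (prefix_value k b).*2 + b k else 0.

Lemma prefix_value_inj n (b w : bits) :
  prefix_value n b = prefix_value n w <-> cylinder n w b.
Proof.
split=> [|bw].
  elim: n => [_ i//|n IH /= e i].
  have e1 : b n = w n.
    by have := congr1 odd e; rewrite !oddD !odd_double /= !oddb.
  have /IH e2 : prefix_value n b = prefix_value n w by move: e; rewrite e1; lia.
  by rewrite ltnS leq_eqVlt => /orP[/eqP->//|]; exact: e2.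
elim: n bw => [//|n IH] bw /=.
by rewrite IH ?bw// => i ni; apply: bw; rewrite ltnS ltnW.
Qed.

Lemma prefix_value_lt n b : (prefix_value n b < 2 ^ n)%N.
Proof.
elim: n => [//|n IH] /=; rewrite expnS; case: (b n); lia.
Qed.

(** The level sets of [prefix_value n] are the cylinders of depth [n]. *)
Lemma measurable_prefix_value n (A : set nat) :
  measurable [set b : coin_space | A (prefix_value n b)].
Proof.
have -> : [set b : coin_space | A (prefix_value n b)] =
    \bigcup_(m in A) [set b | prefix_value n b = m].
  apply/seteqP; split=> [b Ab|b [m Am bm]]; last by rewrite /= bm.
  by exists (prefix_value n b).
apply: bigcup_measurable => m _.
have [[w <-]|/forallNP nw] := pselect (exists w, prefix_value n w = m); last first.
  by rewrite (_ : [set _ | _] = set0)// -subset0 => b; exact: nw.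
rewrite (_ : [set _ | _] = cylinder n w); first exact: measurable_cylinder.
by apply/seteqP; split=> b /prefix_value_inj.
Qed.

Lemma measurable_coin k : measurable_fun setT (fun b : coin_space => b k).
Proof.
move=> _ A _; rewrite setTI.
rewrite (_ : _ @^-1` A =
    [set b : coin_space | [set m | A (odd m)] (prefix_value k.+1 b)]).
  exact: measurable_prefix_value.
by apply/seteqP; split=> b /=; rewrite oddD odd_double oddb.
Qed.

Lemma measurable_fun_coin_space d (T : measurableType d) (f : T -> coin_space) :
  (forall k c, measurable [set w | f w k = c]) -> measurable_fun setT f.
Proof.
move=> mf; apply: (@measurability _ _ _ coin_space _ _ cylinders) => // _ [B [->|[n [w ->]]] <-].
  by rewrite preimage_set0 setI0.
rewrite setTI (_ : _ @^-1` _ = \bigcap_(i in `I_n) [set x | f x i = w i]).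
  by apply: fin_bigcap_measurable => [|i _]; [exact: finite_II|exact: mf].
by [].
Qed.

Lemma measurable_fun_coins d (T : measurableType d) (f : T -> coin_space) :
  (forall k, measurable_fun setT (fun w => f w k)) -> measurable_fun setT f.
Proof.
move=> mf; apply: measurable_fun_coin_space => k c.
by rewrite -[X in measurable X]setTI; exact: (mf k measurableT [set c]).
Qed.

Definition even_bits (b : coin_space) : coin_space := fun i => b i.*2.
Definition odd_bits (b : coin_space) : coin_space := fun i => b i.*2.+1.
Definition interleave (ab : coin_space * coin_space) : coin_space :=
  fun i => if odd i then ab.2 i./2 else ab.1 i./2.

Lemma measurable_even_bits : measurable_fun setT even_bits.
Proof. by apply: measurable_fun_coins => k; exact: measurable_coin. Qed.

Lemma measurable_odd_bits : measurable_fun setT odd_bits.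
Proof. by apply: measurable_fun_coins => k; exact: measurable_coin. Qed.

Lemma measurable_interleave : measurable_fun setT interleave.
Proof.
apply: measurable_fun_coins => k; rewrite /interleave; case: (odd k).
- exact: (@measurableT_comp _ _ _ _ _ _ _ _ _ (measurable_coin k./2) (measurable_snd)).
- exact: (@measurableT_comp _ _ _ _ _ _ _ _ _ (measurable_coin k./2) (measurable_fst)).
Qed.

Lemma interleave_even a b : even_bits (interleave (a, b)) = a.
Proof.
by apply/funext => i; rewrite /even_bits /interleave odd_double doubleK.
Qed.

Lemma interleave_odd a b : odd_bits (interleave (a, b)) = b.
Proof.
apply/funext => i; rewrite /odd_bits /interleave /= odd_double /=.
by rewrite uphalf_double.
Qed.

(** Interleaving pulls a cylinder back to a product of cylinders, so the product
    measure of its preimage is a product of powers of 1/2. *)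
Lemma cylinder_interleave n w : interleave @^-1` cylinder n w =
  cylinder (uphalf n) (even_bits w) `*` cylinder n./2 (odd_bits w).
Proof.
apply/seteqP; split=> -[a b] /=.
  move=> h; split=> i ilt.
    have := h i.*2; rewrite /interleave /= odd_double doubleK; apply.
    lia.
  have := h i.*2.+1; rewrite /interleave /= odd_double /= uphalf_double; apply.
  lia.
move=> [ha hb] i ilt; rewrite /interleave /=.
case: ifP => oi.
  rewrite hb; last lia.
  by rewrite /odd_bits; congr w; lia.
rewrite ha; last lia.
by rewrite /even_bits; congr w; lia.
Qed.

Section coin_tossing.
Context (R : realType).

Local Notation U01 := (uniform_prob (@ltr01 R)).

Lemma uniform_prob01E (A : set R) : measurable A ->
  U01 A = lebesgue_measure (A `&` `[0, 1[).
Proof.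
move=> mA.
have -> : U01 A = lebesgue_measure (A `&` `[0, 1]).
  rewrite /uniform_prob integral_uniform_pdf.
  rewrite (eq_integral (fun=> 1%:E)); last first.
    move=> x; rewrite inE => -[_]; rewrite /= in_itv /= => x01.
    by rewrite /uniform_pdf x01 subr0 invr1.
  by rewrite integral_cst ?mul1e//; exact: measurableI.
have -> : A `&` `[0, 1] = (A `&` `[0, 1[) `|` (A `&` [set 1]).
  by rewrite -setIUr setUitv1 ?bnd_simp ?ler01.
have z : lebesgue_measure (A `&` [set 1]) = 0%E.
  apply: (subset_measure0 _ _ _ (lebesgue_measure_set1 1)) => //.
  exact: measurableI.
have d : (A `&` `[0, 1[) `&` (A `&` [set 1]) = set0.
  rewrite -subset0 => x [[_ +] [_ /= x1]].
  by rewrite /= x1 in_itv /= ltxx andbF.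
rewrite measureU//; try exact: measurableI.
by rewrite [X in (_ + X)%E]z adde0.
Qed.

(** The binary digits of the fractional part of [x >= 0]. *)
Definition digits (x : R) : coin_space :=
  fun k => odd (Num.truncn (2 ^+ k.+1 * x)).

Lemma measurable_digits : measurable_fun [set: measurableTypeR R] digits.
Proof.
apply: measurable_fun_coin_space => k c.
rewrite (_ : [set w | _] = \bigcup_(m in [set m | odd m = c])
   [set x : R | Num.truncn (2 ^+ k.+1 * x) = m]); last first.
  apply/seteqP; split=> [x cx|x [m mc xm]]; last by rewrite /= /digits xm.
  by exists (Num.truncn (2 ^+ k.+1 * x)).
apply: bigcup_measurable => m _.
apply: is_interval_measurable => x y /= xm ym z /andP[xz zy].
apply/eqP; rewrite eqn_leq -{1}ym -{1}xm.
by rewrite !le_truncn// ler_wpM2l// exprn_ge0.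
Qed.

Lemma prefix_value_digits n (x : R) : 0 <= x < 1 ->
  prefix_value n (digits x) = Num.truncn (2 ^+ n * x).
Proof.
move=> /andP[x0 x1]; elim: n => [|n IH] /=.
  by rewrite mul1r; apply/esym/eqP; rewrite truncn_eq// x0.
rewrite {}IH /digits.
set y := 2 ^+ n * x; have y0 : 0 <= y by rewrite mulr_ge0// exprn_ge0.
have -> : 2 ^+ n.+1 * x = 2 * y by rewrite exprS mulrA.
suff -> : Num.truncn y = (Num.truncn (2 * y))./2 by rewrite addnC odd_double_half.
apply/eqP; rewrite truncn_eq//.
have /andP[] : (Num.truncn (2 * y))%:R <= 2 * y < (Num.truncn (2 * y)).+1%:R.
  by rewrite truncn_itv// mulr_ge0.
set m := Num.truncn _ => m1 m2.
have e : m = (odd m + (m./2).*2)%N by rewrite odd_double_half.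
have e1 : m%:R = (odd m)%:R + 2 * (m./2)%:R :> R.
  by rewrite {1}e natrD -muln2 natrM mulrC.
have b0 : 0 <= (odd m)%:R :> R by rewrite ler0n.
have b1 : (odd m)%:R <= 1 :> R by case: (odd m).
rewrite -!natr1 in m2 *; apply/andP; split; lra.
Qed.

Definition coin_digits : {mfun measurableTypeR R >-> coin_space} :=
  HB.pack digits (isMeasurableFun.Build _ _ (measurableTypeR R) coin_space digits
    measurable_digits).

(** The fair coin tossing measure, as the law of the binary digits of a uniform
    variable. *)
Definition coin_prob : probability coin_space R := distribution U01 coin_digits.

Lemma coin_prob_cylinder n w : coin_prob (cylinder n w) = (2^-1 ^+ n)%:E.
Proof.
rewrite /coin_prob /distribution /pushforward /= uniform_prob01E; last first.
  rewrite -[X in measurable X]setTI; apply: measurable_digits => //.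
  exact: measurable_cylinder.
set m := prefix_value n w.
have mlt : (m < 2 ^ n)%N by exact: prefix_value_lt.
have p0 : 0 < 2 ^+ n :> R by rewrite exprn_gt0.
have -> : digits @^-1` cylinder n w `&` `[0, 1[ =
    `[m%:R / 2 ^+ n, m.+1%:R / 2 ^+ n[%classic.
  apply/seteqP; split=> x /=.
    rewrite !in_itv /= => -[/prefix_value_inj + x01].
    rewrite prefix_value_digits// -/m => /eqP.
    have /andP[x0 _] := x01.
    rewrite truncn_eq; last by rewrite mulr_ge0// ltW.
    by rewrite ler_pdivrMr// ltr_pdivlMr// mulrC.
  rewrite !in_itv /= ler_pdivrMr// ltr_pdivlMr// => xm.
  have x0 : 0 <= x.
    rewrite -(pmulr_rge0 _ p0) mulrC; have /andP[+ _] := xm; exact: le_trans.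
  have x1 : x < 1.
    rewrite -(ltr_pM2r p0) mul1r; have /andP[_ h] := xm.
    by apply: (lt_le_trans h); rewrite -natrX ler_nat.
  split; last by rewrite x0.
  apply/prefix_value_inj; rewrite prefix_value_digits ?x0//.
  apply/eqP; rewrite truncn_eq; last by rewrite mulr_ge0// ltW.
  by rewrite mulrC.
rewrite lebesgue_measure_itv /= lte_fin ltr_pM2r ?invr_gt0// ltr_nat leqnn.
by rewrite -EFinB -mulrBl -natrB// subSnn mul1r exprVn.
Qed.

Definition coin_approx (n : nat) (b : coin_space) : R :=
  (prefix_value n b)%:R / 2 ^+ n.

(** The number with the given binary digits, a left inverse of [digits] on
    [[0, 1[]. *)
Definition coin_value (b : coin_space) : R := limn (coin_approx ^~ b).

Lemma coin_approx_cvg b : coin_approx ^~ b @ \oo --> coin_value b.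
Proof.
apply: nondecreasing_is_cvgn.
  apply/nondecreasing_seqP => n.
  rewrite /coin_approx ler_pdivrMr ?exprn_gt0// exprS invfM mulrA mulfVK; last first.
    by rewrite expf_neq0.
  rewrite ler_pdivlMr// -natrM ler_nat /=; lia.
exists 1 => _ [n _ <-]; rewrite /coin_approx ler_pdivrMr ?exprn_gt0// mul1r.
by rewrite -natrX ler_nat ltnW// prefix_value_lt.
Qed.

Lemma measurable_coin_value : measurable_fun setT coin_value.
Proof.
apply: (@measurable_fun_cvg _ _ _ _ coin_approx) => [n|b _]; last first.
  exact: coin_approx_cvg.
move=> _ A _; rewrite setTI.
rewrite (_ : _ @^-1` A = [set b : coin_space |
  [set m | A (m%:R / 2 ^+ n)] (prefix_value n b)]); last by [].
exact: measurable_prefix_value.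
Qed.

Lemma coin_value_digits (x : R) : 0 <= x < 1 -> coin_value (digits x) = x.
Proof.
move=> x01; have /andP[x0 x1] := x01.
apply/cvg_lim => //.
have lo : x - 2^-1 ^+ n @[n --> \oo] --> x.
  rewrite -[X in _ --> X]subr0; apply: cvgB; first exact: cvg_cst.
  by apply: cvg_expr; rewrite ger0_norm// invf_lt1// ltr1n.
apply: (squeeze_cvgr _ lo (cvg_cst x)).
apply: nearW => n; rewrite /coin_approx prefix_value_digits//.
have p0 : 0 < 2 ^+ n :> R by rewrite exprn_gt0.
rewrite ler_pdivlMr// ler_pdivrMr// mulrBl exprVn mulVf ?gt_eqF//.
rewrite lerBlDr natr1 (mulrC x).
have /andP[-> /ltW->//] : (Num.truncn (2 ^+ n * x))%:R <= 2 ^+ n * x <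
    (Num.truncn (2 ^+ n * x)).+1%:R.
by rewrite truncn_itv// mulr_ge0// ltW.
Qed.

(** Both sides are measures that agree on cylinders. *)
Lemma coin_prob_interleave (A : set coin_space) : measurable A ->
  (coin_prob \x coin_prob)%E (interleave @^-1` A) = coin_prob A.
Proof.
pose J : {mfun (coin_space * coin_space)%type >-> coin_space} :=
  HB.pack interleave (isMeasurableFun.Build _ _ _ _ interleave measurable_interleave).
move=> mA.
apply: (@g_sigma_algebra_measure_unique _ R coin_space cylinders _
  (fun=> setT) _ _ (distribution (coin_prob \x coin_prob)%E J) coin_prob) => //.
- move=> _ [->|[n [w ->]]]; first exact: measurable0.
  exact: measurable_cylinder.
- by move=> _; right; exists 0%N, (fun=> false); apply/seteqP; split.
- by apply/seteqP; split=> // x _; exists 0%N.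
- exact: setI_closed_cylinders.
- move=> _ [->|[n [w ->]]]; first by rewrite !measure0.
  rewrite [LHS](_ : _ =
    (coin_prob \x coin_prob)%E (interleave @^-1` cylinder n w))//.
  rewrite cylinder_interleave product_measure1E; try exact: measurable_cylinder.
  rewrite [RHS]coin_prob_cylinder.
  transitivity ((2^-1 ^+ uphalf n)%:E * (2^-1 ^+ n./2)%:E : \bar R)%E.
    by congr (_ * _)%E; exact: coin_prob_cylinder.
  rewrite -EFinM -exprD uphalf_half -addnA addnn.
  by rewrite odd_double_half.
- by move=> _; rewrite -ge0_fin_numE ?measure_ge0// fin_num_measure.
Qed.

Definition uniform_head (x : measurableTypeR R) : R :=
  coin_value (even_bits (digits x)).
Definition uniform_tail (x : measurableTypeR R) : measurableTypeR R :=
  coin_value (odd_bits (digits x)).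

Lemma measurable_uniform_head : measurable_fun setT uniform_head.
Proof.
apply: (measurableT_comp measurable_coin_value).
exact: (measurableT_comp measurable_even_bits measurable_digits).
Qed.

Lemma measurable_uniform_tail : measurable_fun setT uniform_tail.
Proof.
apply: (measurableT_comp measurable_coin_value).
exact: (measurableT_comp measurable_odd_bits measurable_digits).
Qed.

(** The pair of a uniform variable's head and tail has the law of two independent
    uniform variables: the sequences of even and odd digits are independent since
    interleaving two independent sequences of coin tosses gives such a sequence
    again. *)
Lemma uniform_head_tail (A B : set (measurableTypeR R)) :
  measurable A -> measurable B ->
  U01 (uniform_head @^-1` A `&` uniform_tail @^-1` B) = (U01 A * U01 B)%E.
Proof.
move=> mA mB.
have mS (D : set (measurableTypeR R)) : measurable D ->
    measurable (coin_value @^-1` D).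
  by move=> mD; rewrite -[X in measurable X]setTI; exact: measurable_coin_value.
have SE (D : set (measurableTypeR R)) : measurable D ->
    coin_prob (coin_value @^-1` D) = U01 D.
  move=> mD; rewrite /coin_prob /distribution /pushforward /=.
  rewrite !uniform_prob01E//; last first.
    by rewrite -[X in measurable X]setTI; apply: measurable_digits => //; exact: mS.
  congr lebesgue_measure; apply/seteqP.
  by split=> x /=; rewrite in_itv /= => -[+ x01]; rewrite coin_value_digits.
rewrite -(SE _ mA) -(SE _ mB).
set SA := coin_value @^-1` A; set SB := coin_value @^-1` B.
transitivity (coin_prob (even_bits @^-1` SA `&` odd_bits @^-1` SB)); first by [].
rewrite -coin_prob_interleave; last first.
  apply: measurableI; rewrite -[X in measurable X]setTI.
    by apply: measurable_even_bits => //; exact: mS.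
  by apply: measurable_odd_bits => //; exact: mS.
rewrite -product_measure1E; try exact: mS.
congr (_ \x _)%E; apply/seteqP.
by split=> -[a b] /=; rewrite interleave_even interleave_odd.
Qed.

End coin_tossing.

(** * Random variables with countably many values *)

Lemma measurable_discrete disp (T : measurableType disp) (C : countType)
    (U : T -> C) : (forall c, measurable [set w | U w = c]) ->
  forall A : set C, measurable (U @^-1` A).
Proof.
move=> mU A.
rewrite (_ : _ @^-1` A = \bigcup_n [set w | A (U w) /\ pickle (U w) = n]); last first.
  by apply/seteqP; split=> [w Aw|w [n _ []]//]; exists (pickle (U w)).
apply: bigcup_measurable => n _.
have [[c [Ac cn]]|/forallNP nc] := pselect (exists c, A c /\ pickle c = n).
  rewrite (_ : [set _ | _] = [set w | U w = c])//.
  apply/seteqP; split=> w /=; last by move->.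
  by move=> [_ e]; apply: (pcan_inj (@pickleK C)); rewrite e cn.
by rewrite (_ : [set _ | _] = set0)// -subset0 => w h; exact: (nc (U w)).
Qed.

(** Countable additivity reduces a proportionality between [P (E `&` U @^-1` A)] and
    [P (V @^-1` A)] to singletons.  With [A = setT] it computes [P E], with
    [E = setT] it compares two laws. *)
Lemma discrete_disintegration disp (T : measurableType disp) (R : realType)
    (P : probability T R) (C : countType) (U V : T -> C) (E : set T) (x : \bar R) :
  (forall c, measurable [set w | U w = c]) ->
  (forall c, measurable [set w | V w = c]) -> measurable E -> x \is a fin_num ->
  (forall c, P (E `&` [set w | U w = c]) = x * P [set w | V w = c])%E ->
  forall A : set C, P (E `&` U @^-1` A) = (x * P (V @^-1` A))%E.
Proof.
move=> mU mV mE xfin EU A.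
have dec (W : T -> C) : (forall c, measurable [set w | W w = c]) ->
    [/\ W @^-1` A = \bigcup_n [set w | A (W w) /\ pickle (W w) = n],
       forall n, measurable [set w | A (W w) /\ pickle (W w) = n] &
       trivIset setT (fun n => [set w | A (W w) /\ pickle (W w) = n])].
  move=> mW; split.
  - by apply/seteqP; split=> [w Aw|w [n _ []]//]; exists (pickle (W w)).
  - by move=> n; exact: (measurable_discrete mW [set c | A c /\ pickle c = n]).
  - by apply/trivIsetP => i j _ _ ij; rewrite -subset0 => w [[_ wi] [_ wj]];
      move: ij; rewrite -wi -wj eqxx.
have [eU mFU tU] := dec U mU; have [eV mFV tV] := dec V mV.
rewrite eU eV setI_bigcupr measure_bigcup//; last 2 first.
- by move=> n _; exact: measurableI.
- apply/trivIsetP => i j _ _ ij; rewrite setIACA.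
  by move/trivIsetP : tU => ->//; rewrite setI0.
rewrite measure_bigcup// -(fineK xfin) -nneseriesZl//.
apply: eq_eseriesr => n _.
have [[c [Ac cn]]|/forallNP nc] := pselect (exists c, A c /\ pickle c = n).
  have e (W : T -> C) : [set w | A (W w) /\ pickle (W w) = n] = [set w | W w = c].
    apply/seteqP; split=> w /=; last by move->.
    by move=> [_ e]; apply: (pcan_inj (@pickleK C)); rewrite e cn.
  by rewrite !e fineK//; exact: EU.
have e (W : T -> C) : [set w | A (W w) /\ pickle (W w) = n] = set0.
  by rewrite -subset0 => w h; exact: (nc (W w)).
by rewrite !e setI0 measure0 mule0.
Qed.

Lemma discrete_same_law disp (T : measurableType disp) (R : realType)
    (P : probability T R) (C : countType) (U V : T -> C) :
  (forall c, measurable [set w | U w = c]) ->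
  (forall c, measurable [set w | V w = c]) ->
  (forall c, P [set w | U w = c] = P [set w | V w = c]) ->
  forall A : set C, P (U @^-1` A) = P (V @^-1` A).
Proof.
move=> mU mV UV A.
rewrite -[U @^-1` A]setTI -[RHS]mul1e.
by apply: discrete_disintegration => // c; rewrite setTI mul1e.
Qed.

(** The points are replaced by sets one index at a time; [G m c] is the family with
    sets at the first [m] indices. *)
Lemma discrete_independent disp (T : measurableType disp) (R : realType)
    (P : probability T R) (C : countType) (c0 : C) (n : nat) (U : nat -> T -> C) :
  (forall k c, measurable [set w | U k w = c]) ->
  (forall c : nat -> C, P (\bigcap_(k < n) [set w | U k w = c k]) =
     (\prod_(k < n) P [set w | U k w = c k])%E) ->
  forall A : nat -> set C, P (\bigcap_(k < n) (U k @^-1` A k)) =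
    (\prod_(k < n) P (U k @^-1` A k))%E.
Proof.
move=> mU ind A.
pose G m (c : nat -> C) k : set C := if (k < m)%N then A k else [set c k].
have H m : (m <= n)%N -> forall c, P (\bigcap_(k < n) (U k @^-1` G m c k)) =
    (\prod_(k < n) P (U k @^-1` G m c k))%E.
  elim: m => [_ c|m IH mn c]; first exact: ind.
  pose Gm k := U k @^-1` G m.+1 c k.
  pose E := \bigcap_(k in [set k | (k < n)%N /\ k != m]) Gm k.
  pose x := (\prod_(k < n | k != Ordinal mn) P (Gm k))%E.
  have mE : measurable E.
    apply: bigcap_measurableType => k _; exact: measurable_discrete.
  have capE (F : nat -> set C) : (forall k, k != m -> G m.+1 c k = F k) ->
      \bigcap_(k < n) (U k @^-1` F k) = E `&` U m @^-1` F m.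
    move=> GF; apply/seteqP; split=> w.
      by move=> h; split=> [k [kn km]|]; [rewrite /Gm GF//; exact: h|exact: h].
    move=> [h1 h2] k kn; have [->//|km] := eqVneq k m.
    by rewrite -GF//; exact: h1.
  rewrite (capE (G m.+1 c))//.
  rewrite (discrete_disintegration (x := x) (V := U m))//.
  - by rewrite (bigD1 (Ordinal mn))//= muleC.
  - by apply: prode_fin_num => k _; rewrite fin_num_measure//; exact: measurable_discrete.
  move=> a.
  pose c' k := if k == m then a else c k.
  have GE k : k != m -> G m.+1 c k = G m c' k.
    by move=> km; rewrite /G /c' (negbTE km) ltnS leq_eqVlt (negbTE km).
  have := IH (ltnW mn) c'.
  rewrite (capE (G m c'))// (bigD1 (Ordinal mn))//= muleC.
  have -> : U m @^-1` G m c' m = [set w | U m w = a].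
    by rewrite /G ltnn /c' eqxx.
  move=> ->; congr (_ * _)%E; apply: eq_bigr => k km.
  by rewrite /Gm GE.
rewrite (_ : \bigcap_(k < n) _ = \bigcap_(k < n) (U k @^-1` G n (fun=> c0) k)); last first.
  by apply: eq_bigcapr => k kn; rewrite /G kn.
rewrite H//; apply: eq_bigr => k _.
by rewrite /G ltn_ord.
Qed.

(** * A marked Poisson process *)

Section arrivals.
Context (R : realType) (k : nat).

Local Notation Omega := (measurableTypeR R).
Local Notation K := (k.+1%:R : R).
Local Notation P := (uniform_prob (@ltr01 R)).

(** The integer part of [K u] is uniform on the marks, and independent of the
    fractional part of [K u], which is uniform on [[0, 1[]. *)
Definition mark (u : R) : 'I_k.+1 := inord (Num.truncn (K * u)).

(** Minus the logarithm of a uniform variable, divided by [K], is exponential of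
    parameter [K].  The value at the points where the fractional part of [K u]
    vanishes has no influence on laws, but being positive it ensures that all the
    arrival times are distinct. *)
Definition gap (u : R) : R :=
  let v := K * u - (Num.truncn (K * u))%:R in
  if 0 < v then - ln v / K else 1.

Definition gap_at i (w : Omega) : R := gap (uniform_head (iter i (@uniform_tail R) w)).
Definition mark_at i (w : Omega) : 'I_k.+1 :=
  mark (uniform_head (iter i (@uniform_tail R) w)).

Definition arrival n w : R := \sum_(i < n.+1) gap_at i w.

Definition non_explosive : set Omega :=
  [set w | forall m : nat, exists n, m%:R < arrival n w].

(** The number of arrivals up to time [t], read as 0 on explosive paths so that it is
    non-decreasing in [t] on every path. *)
Definition count (t : R) (w : Omega) : nat :=
  match pselect (non_explosive w /\ exists n, t < arrival n w) with
  | left h => ex_minn (proj2 h)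
  | right _ => 0
  end.

(** The marks of the arrivals in the interval from [s] (excluded) to [t] (included), in
    order of arrival.  Increments of the jump process are functions of these words. *)
Definition word (s t : R) (w : Omega) : seq 'I_k.+1 :=
  [seq mark_at i w | i <- index_iota (count s w) (count t w)].

Lemma gap_gt0 u : 0 < gap u.
Proof.
rewrite /gap; case: ifPn => // v0.
rewrite divr_gt0// oppr_gt0 ln_lt0// v0 /= ltrBlDr addrC natr1.
exact: truncnS_gt.
Qed.

Lemma arrivalS n w : arrival n.+1 w = arrival n w + gap_at n.+1 w.
Proof. by rewrite /arrival big_ord_recr. Qed.

Lemma arrival0 w : arrival 0 w = gap_at 0 w.
Proof. by rewrite /arrival big_ord1. Qed.

Lemma arrival_tail n w :
  arrival n.+1 w = gap_at 0 w + arrival n (uniform_tail w).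
Proof.
rewrite /arrival big_ord_recl; congr (_ + _); apply: eq_bigr => i _.
by rewrite /gap_at lift0 iterSr.
Qed.

Lemma arrival_lt : forall w m n, (m < n)%N -> arrival m w < arrival n w.
Proof.
move=> w m n; elim: n => [//|n IH]; rewrite ltnS leq_eqVlt arrivalS.
move=> /orP[/eqP->|/IH h]; first by rewrite ltrDl gap_gt0.
by rewrite (lt_trans h)// ltrDl gap_gt0.
Qed.

Lemma arrival_le w m n : (m <= n)%N -> arrival m w <= arrival n w.
Proof. by rewrite leq_eqVlt => /orP[/eqP->//|/arrival_lt/ltW]. Qed.

Lemma arrival_gt0 n w : 0 < arrival n w.
Proof.
by apply: (@lt_le_trans _ _ (arrival 0 w)); rewrite ?arrival_le// arrival0 gap_gt0.
Qed.

Lemma non_explosive_exists w t : non_explosive w -> exists n, t < arrival n w.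
Proof.
move=> /(_ (Num.truncn t).+1)[n h]; exists n.
by apply: lt_trans h; rewrite truncnS_gt.
Qed.

Lemma count_le w t n : non_explosive w -> (count t w <= n)%N = (t < arrival n w).
Proof.
move=> g; rewrite /count; case: pselect => [h|]; last first.
  by case; split=> //; exact: non_explosive_exists.
case: ex_minnP => m tm mmin; apply/idP/idP => [mn|/mmin//].
by apply: lt_le_trans tm _; exact: arrival_le.
Qed.

Lemma count_explosive w t : ~ non_explosive w -> count t w = 0.
Proof. by move=> g; rewrite /count; case: pselect => // -[]. Qed.

Lemma le_count w s t : s <= t -> (count s w <= count t w)%N.
Proof.
move=> st; have [g|g] := pselect (non_explosive w); last first.
  by rewrite !count_explosive.
by rewrite count_le// (le_lt_trans st)// -count_le.
Qed.

Lemma count0 w : count 0 w = 0.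
Proof.
have [g|g] := pselect (non_explosive w); last by rewrite count_explosive.
by apply/eqP; rewrite -leqn0 count_le// arrival_gt0.
Qed.

Lemma size_word s t w : size (word s t w) = (count t w - count s w)%N.
Proof. by rewrite size_map size_iota. Qed.

Lemma word_cat r s t w : r <= s -> s <= t ->
  word r t w = word r s w ++ word s t w.
Proof.
move=> rs st; rewrite /word -map_cat /index_iota; congr map.
have := le_count w rs; have := le_count w st.
move: (count r w) (count s w) (count t w) => a b c bc ab.
have -> : (c - a = (b - a) + (c - b))%N by lia.
by rewrite iotaD subnKC.
Qed.

Lemma non_explosive_tail w : non_explosive w <-> non_explosive (uniform_tail w).
Proof.
split=> g m.
  have [n] := non_explosive_exists (m%:R + gap_at 0 w) g.
  case: n => [|n]; last first.
    by rewrite arrival_tail addrC ltrD2l => h; exists n.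
  rewrite arrival0 => h; exists 0%N.
  by have := arrival_gt0 0 (uniform_tail w); lra.
have [n h] := g m; exists n.+1; rewrite arrival_tail (lt_trans h)//.
by rewrite ltrDr gap_gt0.
Qed.

Lemma count_tail w t : non_explosive w ->
  count t w = if t < gap_at 0 w then 0%N
              else (count (t - gap_at 0 w) (uniform_tail w)).+1.
Proof.
move=> g; have g' := (non_explosive_tail w).1 g.
case: ifPn => tg.
  by apply/eqP; rewrite -leqn0 count_le// arrival0.
apply/eqP; rewrite eqn_leq count_le// arrival_tail -ltrBlDl -count_le// leqnn /=.
have : (0 < count t w)%N by rewrite ltnNge count_le// arrival0.
case e : (count t w) => [//|n] _; rewrite ltnS count_le//.
by rewrite ltrBlDl -arrival_tail -count_le// e.
Qed.

Lemma word_tail s t w : non_explosive w -> gap_at 0 w <= s -> s <= t ->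
  word s t w = word (s - gap_at 0 w) (t - gap_at 0 w) (uniform_tail w).
Proof.
move=> g gs st; rewrite /word !(count_tail _ g) !ltNge gs (le_trans gs st) /=.
rewrite /index_iota subSS (iotaDl 1) -map_comp; apply: eq_map => i /=.
by rewrite /mark_at -iterSr.
Qed.

Lemma word_cons s t w : non_explosive w -> s < gap_at 0 w -> gap_at 0 w <= t ->
  word s t w = mark_at 0 w :: word 0 (t - gap_at 0 w) (uniform_tail w).
Proof.
move=> g sg gt; rewrite /word count0 !(count_tail _ g) sg ltNge gt /=.
rewrite /index_iota !subn0 (iotaDl 1 0) -map_comp.
congr (_ :: _); apply: eq_map => i /=.
by rewrite /mark_at -iterSr.
Qed.

Fixpoint shift (x : R) (r : seq (R * seq 'I_k.+1)) :=
  if r is (t, u) :: r' then (t - x, u) :: shift x r' else [::].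

(** A path from time [s] on is described by a list of words over successive
    intervals, each word coming with the end of its interval. *)
Fixpoint chain (s : R) (r : seq (R * seq 'I_k.+1)) (w : Omega) : Prop :=
  if r is (t, u) :: r' then word s t w = u /\ chain t r' w else True.

Fixpoint increasing (s : R) (r : seq (R * seq 'I_k.+1)) : Prop :=
  if r is (t, u) :: r' then s <= t /\ increasing t r' else True.

(** The period without arrivals up to [c] makes this family of events stable under
    renewal: removing an empty first word or the first letter of a word gives such an
    event again. *)
Definition history c r : set Omega :=
  [set w | [/\ non_explosive w, count c w = 0%N & chain c r w]].

Lemma chain_tail s r w : non_explosive w -> gap_at 0 w <= s -> increasing s r ->
  chain s r w <-> chain (s - gap_at 0 w) (shift (gap_at 0 w) r) (uniform_tail w).
Proof.
move=> g; elim: r s => [//|[t u] r IH] s gs /= [st tr].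
by rewrite (word_tail g gs st) (IH t (le_trans gs st) tr).
Qed.

(** An empty first word only extends the initial period without arrivals. *)
Lemma history_nil_word c t r : c <= t -> history c ((t, [::]) :: r) = history t r.
Proof.
move=> ct; apply/seteqP; split=> w [g].
  move=> c0 /= [e tr]; split=> //.
  by have := size_word c t w; rewrite e c0 subn0.
move=> t0 tr; have c0 : count c w = 0%N.
  by apply/eqP; rewrite -leqn0 -t0 le_count.
by split=> //=; split=> //; apply/nilP; rewrite /nilp size_word t0.
Qed.

(** Renewal: the first arrival has the prescribed mark [j] and a time [x] between
    [c] and [t], and the tail has the remaining history, counted from time [x]. *)
Lemma history_cons_word c t j u r w : increasing t r ->
  history c ((t, j :: u) :: r) w <->
  [/\ c < gap_at 0 w, gap_at 0 w <= t, mark_at 0 w = j &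
      history 0 ((t - gap_at 0 w, u) :: shift (gap_at 0 w) r) (uniform_tail w)].
Proof.
move=> tr; split.
  move=> [g c0 /= [e ctr]].
  have cg : c < gap_at 0 w by rewrite -arrival0 -count_le// c0.
  have gt : gap_at 0 w <= t.
    rewrite leNgt -arrival0 -count_le//.
    by have := size_word c t w; rewrite e c0 subn0 => <-.
  move: e; rewrite (word_cons g cg gt) => -[ej eu].
  split=> //; split=> //=; first exact: (non_explosive_tail w).1.
    by rewrite count0.
  by split=> //; apply/(chain_tail g gt tr).
move=> [cg gt ej [/(non_explosive_tail w).2 g _ /= [eu ctr]]].
split=> //=; first by apply/eqP; rewrite -leqn0 count_le// arrival0.
split; last exact/(chain_tail g gt tr).
by rewrite (word_cons g cg gt) ej eu.
Qed.

Lemma history_nil c : history c [::] = non_explosive `&` [set w | c < gap_at 0 w].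
Proof.
apply/seteqP; split=> w /=.
  by move=> [g c0 _]; split=> //; rewrite -arrival0 -count_le// c0.
by move=> [g cg]; split=> //; apply/eqP; rewrite -leqn0 count_le// arrival0.
Qed.

Lemma measurable_mark j : measurable [set u | mark u = j].
Proof.
rewrite (_ : [set u | _] = \bigcup_(m in [set m | inord m = j])
   [set u : R | Num.truncn (K * u) = m]); last first.
  apply/seteqP; split=> [x cx|x [m mc xm]]; last by rewrite /= /mark xm.
  by exists (Num.truncn (K * x)).
apply: bigcup_measurable => m _.
apply: is_interval_measurable => x y /= xm ym z /andP[xz zy].
apply/eqP; rewrite eqn_leq -{1}ym -{1}xm.
by rewrite !le_truncn// ler_wpM2l.
Qed.

Lemma measurable_gap : measurable_fun [set: Omega] (gap : Omega -> R).
Proof.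
have mv : measurable_fun setT (fun u : R => K * u - (Num.truncn (K * u))%:R).
  apply: measurable_funB; first exact: measurable_funM.
  apply: nondecreasing_measurable => // x y xy.
  by rewrite ler_nat le_truncn// ler_wpM2l.
apply: measurable_fun_ifT => //.
- exact: measurable_fun_ltr.
- apply: measurable_funM => //.
  apply: measurableT_comp => //.
  by apply: (measurableT_comp (@measurable_ln R)).
Qed.

Lemma measurable_iter_tail i :
  measurable_fun [set: Omega] (iter i (@uniform_tail R)).
Proof.
elim: i => [|i IH]; first exact: measurable_id.
exact: (measurableT_comp (@measurable_uniform_tail R) IH).
Qed.

Lemma measurable_gap_at i : measurable_fun [set: Omega] (gap_at i).
Proof.
apply: (measurableT_comp measurable_gap).
exact: (measurableT_comp (@measurable_uniform_head R) (measurable_iter_tail i)).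
Qed.

Lemma measurable_arrival n : measurable_fun [set: Omega] (arrival n).
Proof. by apply: measurable_sum => i; exact: measurable_gap_at. Qed.

Lemma measurable_mark_at i j : measurable [set w : Omega | mark_at i w = j].
Proof.
have mh : measurable_fun [set: Omega]
    (@uniform_head R \o iter i (@uniform_tail R)).
  exact: (measurableT_comp (@measurable_uniform_head R) (measurable_iter_tail i)).
have := mh measurableT _ (measurable_mark j).
by rewrite setTI.
Qed.

Lemma measurable_non_explosive : measurable non_explosive.
Proof.
rewrite (_ : non_explosive = \bigcap_m \bigcup_n [set w | m%:R < arrival n w]).
  apply: bigcapT_measurable => m; apply: bigcup_measurable => n _.
  rewrite -[X in measurable X]setTI.
  have := measurable_arrival n measurableT (measurable_itv `]m%:R, +oo[).
  by rewrite preimage_itvoy.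
apply/seteqP; split=> w h m; first by move=> _; have [n ?] := h m; exists n.
by have [n _ ?] := h m I; exists n.
Qed.

Section joint.
Context (d : measure_display) (Z : measurableType d) (W : Z -> Omega)
  (mW : measurable_fun setT W).

Lemma measurable_preimage_W (A : set Omega) : measurable A -> measurable [set z | A (W z)].
Proof. by move=> mA; rewrite -[X in measurable X]setTI; exact: mW. Qed.

(** Measurability is needed jointly in time and outcome, because the history of
    the tail is shifted by the random time of the first arrival. *)
Lemma measurable_count_le (s : Z -> R) n : measurable_fun setT s ->
  measurable [set z | (count (s z) (W z) <= n)%N].
Proof.
move=> ms.
rewrite (_ : [set z | _] = ([set z | non_explosive (W z)] `&`
    [set z | s z < arrival n (W z)]) `|` [set z | (~` non_explosive) (W z)]).
  apply: measurableU.
    apply: measurableI; first exact: (measurable_preimage_W measurable_non_explosive).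
    have := measurable_fun_ltr ms (measurableT_comp (measurable_arrival n) mW).
    move=> /(_ measurableT [set true]); rewrite setTI; exact.
  exact: (measurable_preimage_W (measurableC measurable_non_explosive)).
apply/seteqP; split=> z /=.
  have [g|g] := pselect (non_explosive (W z)); last by right.
  by rewrite count_le//; left.
by move=> [[g h]|g]; [rewrite count_le|rewrite count_explosive].
Qed.

Lemma measurable_count (s : Z -> R) n : measurable_fun setT s ->
  measurable [set z | count (s z) (W z) = n].
Proof.
move=> ms; case: n => [|n].
  rewrite (_ : [set z | _] = [set z | (count (s z) (W z) <= 0)%N]).
    exact: measurable_count_le.
  by apply/seteqP; split=> z /=; [move->|rewrite leqn0 => /eqP].
rewrite (_ : [set z | _] = [set z | (count (s z) (W z) <= n.+1)%N] `\`
   [set z | (count (s z) (W z) <= n)%N]).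
  by apply: measurableD; exact: measurable_count_le.
apply/seteqP; split=> z /=; first by move->; rewrite ltnn.
by move=> [h1 /negP h2]; apply/eqP; rewrite eqn_leq h1 ltnNge.
Qed.

Lemma measurable_marks (l : seq nat) u :
  measurable [set z | [seq mark_at i (W z) | i <- l] = u].
Proof.
elim: l u => [|i l IH] [|j u] /=.
- by rewrite (_ : [set _ | _] = setT)//; apply/seteqP; split.
- by rewrite (_ : [set _ | _] = set0)//; apply/seteqP; split.
- by rewrite (_ : [set _ | _] = set0)//; apply/seteqP; split.
rewrite (_ : [set _ | _] = [set z | mark_at i (W z) = j] `&`
    [set z | [seq mark_at i (W z) | i <- l] = u]).
  by apply: measurableI => //; exact: (measurable_preimage_W (measurable_mark_at i j)).
by apply/seteqP; split=> z /= [-> ->].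
Qed.

Lemma measurable_word (s t : Z -> R) u :
  measurable_fun setT s -> measurable_fun setT t ->
  measurable [set z | word (s z) (t z) (W z) = u].
Proof.
move=> ms mt.
rewrite (_ : [set z | _] = \bigcup_a \bigcup_b
  ([set z | count (s z) (W z) = a] `&` [set z | count (t z) (W z) = b] `&`
   [set z | [seq mark_at i (W z) | i <- index_iota a b] = u])).
  apply: bigcup_measurable => a _; apply: bigcup_measurable => b _.
  by apply: measurableI; [apply: measurableI; exact: measurable_count|
    exact: measurable_marks].
apply/seteqP; split=> z /=.
  by move=> e; exists (count (s z) (W z)) => //; exists (count (t z) (W z)).
by move=> [a _ [b _ [[<- <-]]]].
Qed.

Lemma measurable_chain (s x : Z -> R) (r : seq (R * seq 'I_k.+1)) :
  measurable_fun setT s -> measurable_fun setT x ->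
  measurable [set z | chain (s z) (shift (x z) r) (W z)].
Proof.
move=> + mx; elim: r s => [|[t u] r IH] s ms /=.
  by rewrite (_ : [set _ | _] = setT)//; apply/seteqP; split.
have mt : measurable_fun setT (fun z => t - x z) by exact: measurable_funB.
by apply: measurableI; [exact: measurable_word|exact: IH].
Qed.

Lemma measurable_history_shift (c : R) (x : Z -> R) (r : seq (R * seq 'I_k.+1)) :
  measurable_fun setT x ->
  measurable [set z | history c (shift (x z) r) (W z)].
Proof.
move=> mx.
rewrite (_ : [set _ | _] = [set z | non_explosive (W z)] `&`
  [set z | count c (W z) = 0%N] `&` [set z | chain c (shift (x z) r) (W z)]).
  apply: measurableI; last exact: measurable_chain.
  apply: measurableI; first exact: (measurable_preimage_W measurable_non_explosive).
  exact: measurable_count.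
by apply/seteqP; split=> z [] => [|[]]; split.
Qed.

End joint.

Definition step_set (j : 'I_k.+1) (c t : R) : set Omega :=
  [set u | [/\ c < gap u, gap u <= t & mark u = j]].

(** The points where [gap] takes its default value; they form a null set. *)
Definition lattice : set R := range (fun i : nat => i%:R / K).

Lemma countable_lattice : countable lattice.
Proof. by apply: sub_countable (card_image_le _ _) _. Qed.

Let K_gt0 : 0 < K. Proof. by []. Qed.

Lemma gapE (j : 'I_k.+1) u : 0 < K * u - j%:R < 1 ->
  mark u = j /\ gap u = - ln (K * u - j%:R) / K.
Proof.
move=> /andP[h0 h1].
have e : Num.truncn (K * u) = j.
  apply: truncn_def; rewrite -[X in _ < X]natr1.
  by apply/andP; split; lra.
split; first by apply: val_inj; rewrite /= /mark e inordK.
by rewrite /gap e h0.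
Qed.

Lemma gap_le v t : 0 < v -> (- ln v / K <= t) = (expR (- K * t) <= v).
Proof.
move=> v0; rewrite ler_pdivrMr// lerNl -[in RHS](lnK v0) ler_expR.
by rewrite mulNr mulrC.
Qed.

(** Away from the lattice, [K * u] lies between [j] and [j.+1] and [gap u] decreases from
    infinity to 0 there. *)
Lemma step_set_interval j c t : 0 <= c -> c <= t ->
  (`[0, 1] `&` step_set j c t) `\` lattice =
  `[(j%:R + expR (- K * t)) / K, (j%:R + expR (- K * c)) / K[%classic.
Proof.
move=> c0 ct; apply/seteqP; split=> u /=.
  rewrite !in_itv /= => -[[/andP[u0 u1] [cu ut uj]] ul].
  have Ku : 0 <= K * u by rewrite mulr_ge0.
  have u1' : u < 1.
    rewrite lt_neqAle u1 andbT; apply/eqP => e; apply: ul.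
    by exists k.+1 => //; rewrite e divff.
  have mK : (Num.truncn (K * u) < k.+1)%N.
    by rewrite truncn_lt_nat// gtr_pMr.
  have mj : Num.truncn (K * u) = j.
    by move/(congr1 val) : uj; rewrite /= /mark inordK.
  have v0 : 0 < K * u - j%:R.
    rewrite lt_def subr_ge0 -mj truncn_le Ku andbT subr_eq0; apply/eqP => e.
    by apply: ul; exists (Num.truncn (K * u)) => //; rewrite -e [K * u]mulrC mulfK.
  have v1 : K * u - j%:R < 1.
    by rewrite ltrBlDl natr1 -mj truncnS_gt.
  have v01 : 0 < K * u - j%:R < 1 by rewrite v0.
  have [_ gu] := gapE v01.
  move: cu ut; rewrite gu ltNge !gap_le// -ltNge => cu ut.
  by rewrite ler_pdivrMr// ltr_pdivlMr// -lerBrDl -ltrBlDl (mulrC u) cu ut.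
rewrite !in_itv /= ler_pdivrMr// ltr_pdivlMr// -lerBrDl -ltrBlDl (mulrC u).
move=> /andP[ut uc].
have v0 : 0 < K * u - j%:R by exact: lt_le_trans (expR_gt0 _) ut.
have v1 : K * u - j%:R < 1.
  by apply: lt_le_trans uc _; rewrite -expR0 ler_expR mulNr oppr_le0 mulr_ge0.
have v01 : 0 < K * u - j%:R < 1 by rewrite v0.
have [uj gu] := gapE v01.
have jK : j%:R + 1 <= K by rewrite natr1 ler_nat.
have j0 : 0 <= j%:R :> R by [].
split; last first.
  move=> [i _ iu].
  have e : K * u = i%:R by rewrite -iu mulrC divfK.
  move: v0 v1; rewrite e subr_gt0 ltrBlDl natr1 !ltr_nat; lia.
split.
  apply/andP; split.
    by rewrite -(pmulr_rge0 _ K_gt0); lra.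
  by rewrite -(ler_pM2l K_gt0) mulr1; lra.
split=> //; last by rewrite gu// gap_le.
by rewrite gu// ltNge gap_le// -ltNge.
Qed.

Lemma measurable_step_set j c t : measurable (step_set j c t).
Proof.
rewrite (_ : step_set j c t = [set u | mark u = j] `&`
   (gap @^-1` `]c, t])); last first.
  apply/seteqP; split=> u /=; rewrite in_itv /=.
    by move=> [h1 h2 h3]; split=> //; rewrite h1 h2.
  by move=> [h1 /andP[h2 h3]]; split.
apply: measurableI; first exact: measurable_mark.
by rewrite -[X in measurable X]setTI; apply: measurable_gap.
Qed.

Lemma step_set_integral j c t (f : Omega -> \bar R) : 0 <= c -> c <= t ->
  measurable_fun setT f -> (forall u, 0 <= f u)%E ->
  (\int[P]_(u in step_set j c t) f u =
   \int[lebesgue_measure]_(u in `[((j%:R + expR (- K * t)) / K)%R,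
       ((j%:R + expR (- K * c)) / K)%R[) f u)%E.
Proof.
move=> c0 ct mf f0.
rewrite integral_mkcond integral_uniform; last 2 first.
- apply/(measurable_restrictT _ _).1 => //; first exact: measurable_step_set.
  exact: measurable_funS mf.
- by move=> u; rewrite patchE; case: ifP.
rewrite subr0 invr1 mul1e -integral_mkcondr.
rewrite -(step_set_interval j c0 ct).
apply: (@ge0_negligible_integral _ _ _ lebesgue_measure
  (`[0%R, 1%R] `&` step_set j c t) lattice f).
- apply: countable_measurable.
  by move=> x; exact: measurable_set1.
  exact: countable_lattice.
- by apply: measurableI => //; exact: measurable_step_set.
- exact: measurable_funS mf.
- by [].
- by apply: countable_lebesgue_measure0; exact: countable_lattice.
Qed.


(** The primitive is obtained from the substitution of [x] for [- ln (K * u - j) / K]. *)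
Lemma integral_log_power (j : 'I_k.+1) c t n : 0 <= c -> c < t ->
  (\int[lebesgue_measure]_(u in `[((j%:R + expR (- K * t)) / K)%R,
       ((j%:R + expR (- K * c)) / K)%R])
     (expR (- K * t) / (K * u - j%:R) *
       ((t + ln (K * u - j%:R) / K) ^+ n / n`!%:R))%:E =
   (expR (- K * t) * ((t - c) ^+ n.+1 / n.+1`!%:R))%:E)%E.
Proof.
move=> c0 ct; set a := (_ / K)%R; set b := (_ / K)%R.
pose h u : R := expR (- K * t) / (K * u - j%:R) *
   ((t + ln (K * u - j%:R) / K) ^+ n / n`!%:R).
pose F u : R := expR (- K * t) * ((t + ln (K * u - j%:R) / K) ^+ n.+1 / n.+1`!%:R).
have ab : a < b.
  by rewrite ltr_pM2r ?invr_gt0// ltrD2l ltr_expR !mulNr ltrN2 ltr_pM2l.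
have pos u : u \in `[a, b] -> 0 < K * u - j%:R.
  rewrite in_itv /= => /andP[+ _]; rewrite ler_pdivrMr// (mulrC u) -lerBrDl.
  exact: lt_le_trans (expR_gt0 _).
have Kn0 : K != 0 by rewrite pnatr_eq0.
pose q : {poly R} := K *: 'X - (j%:R)%:P.
have qE u : q.[u] = K * u - j%:R by rewrite !hornerE.
pose p m : {poly R} := (t%:P + K^-1 *: 'X) ^+ m.
have pE m y : (p m).[y] = (t + y / K) ^+ m by rewrite !hornerE mulrC.
have dpE m y : (p m.+1)^`().[y] = m.+1%:R * (t + y / K) ^+ m / K.
  rewrite deriv_exp /= derivD derivC derivZ derivX add0r.
  rewrite hornerMn hornerM horner_exp !hornerE /= -mulr_natl (mulrC K^-1 y).
  by rewrite [RHS]mulrC mulrCA.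
have dlnq u : 0 < q.[u] ->
    is_derive u 1 (@ln R \o horner q) ((q.[u])^-1 * K).
  move=> u0; apply: is_derive1_comp; first exact: is_derive1_ln.
  apply: is_derive_eq; rewrite derivB derivC derivZ derivX subr0.
  by rewrite !hornerE.
have dpq m u : 0 < q.[u] ->
    is_derive u 1 (horner (p m) \o (@ln R \o horner q))
      ((p m)^`().[ln q.[u]] * ((q.[u])^-1 * K)).
  by move=> u0; apply: is_derive1_comp; exact: dlnq.
have dF u : u \in `[a, b] -> is_derive u 1 F (h u).
  move=> /pos u0; rewrite -qE in u0.
  have -> : F = (expR (- K * t) / n.+1`!%:R) \*:
      (horner (p n.+1) \o (@ln R \o horner q)).
    apply/funext => x; rewrite /F /= pE qE /GRing.scale /=.
    by rewrite mulrAC mulrA.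
  apply: is_derive_eq; first exact: (is_deriveZ _ (dpq n.+1 u u0)).
  rewrite dpE /h -qE factS natrM /GRing.scale /=.
  have n0 : n.+1%:R != 0 :> R by rewrite pnatr_eq0.
  have f0 : n`!%:R != 0 :> R by rewrite pnatr_eq0 -lt0n fact_gt0.
  have q0 : q.[u] != 0 by rewrite gt_eqF.
  set X := expR _; set Y := _ ^+ n; clearbody X Y.
  move: n0 f0 q0 Kn0.
  move: (n.+1%:R : R) (n`!%:R : R) (q.[u]) K => N f z L N0 f0 z0 L0.
  by field; rewrite N0 L0 f0 z0.
have dh u : u \in `[a, b] -> derivable h u 1.
  move=> /pos u0; rewrite -qE in u0.
  have -> : h = (expR (- K * t) / n`!%:R) \*: ((fun x => (horner q x)^-1) *
      (horner (p n) \o (@ln R \o horner q))).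
    apply/funext => x; rewrite /h /= /GRing.scale /=.
    rewrite [(_ * _) x]/(GRing.mul _ _) /= pE qE.
    by rewrite -!mulrA; congr (_ * _); rewrite [RHS]mulrC mulrA.
  apply: derivableZ; apply: derivableM.
    have q0 : q.[u] != 0 by rewrite gt_eqF.
    by have [] := is_deriveV q0 (is_derive_poly q u).
  by have [] := dpq n u u0.
have -> : (t - c) = t + ln (K * b - j%:R) / K.
  by rewrite /b [K * _]mulrC divfK// addrAC subrr add0r expRK; field.
rewrite (@continuous_FTC2 _ h F a b)//.
- rewrite -EFinB /F; congr EFin.
  have -> : t + ln (K * a - j%:R) / K = 0.
    by rewrite /a [K * _]mulrC divfK// addrAC subrr add0r expRK; field.
  by rewrite expr0n /= mul0r mulr0 subr0.
- by apply: derivable_within_continuous => u uab; exact: dh.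
- have cF u : u \in `[a, b] -> {for u, continuous F}.
    move=> uab; apply: differentiable_continuous; apply/derivable1_diffP.
    by have := dF u uab; case.
  split.
  + by move=> u uab; have := dF u (subset_itv_oo_cc uab); case.
  + by apply: cvg_at_right_filter; apply: cF; rewrite in_itv /= lexx ltW.
  + by apply: cvg_at_left_filter; apply: cF; rewrite in_itv /= lexx ltW.
- move=> u uab; have d := dF u (subset_itv_oo_cc uab).
  by rewrite derive1E derive_val.
Qed.

Lemma step_interval_lt1 (j : 'I_k.+1) c t u : 0 <= c ->
  u \in `[(j%:R + expR (- K * t)) / K, (j%:R + expR (- K * c)) / K[ ->
  0 < K * u - j%:R < 1.
Proof.
have K0 : 0 < K by [].
move=> c0; rewrite in_itv /= ler_pdivrMr// ltr_pdivlMr// -lerBrDl -ltrBlDl.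
rewrite (mulrC u) => /andP[ut uc].
rewrite (lt_le_trans (expR_gt0 _) ut) /= (lt_le_trans uc)//.
by rewrite -expR0 ler_expR mulNr oppr_le0 mulr_ge0.
Qed.

(** Among the first arrivals those of mark [j] have density [exp (- K x)] in their
    time [x], so this is the integral of [exp (- K t) (t - x)^n / n!] over [x]
    between [c] and [t]. *)
Lemma step_set_poisson (j : 'I_k.+1) c t n : 0 <= c -> c <= t ->
  (\int[P]_(u in step_set j c t)
     (expR (- K * (t - gap u)) * ((t - gap u) ^+ n / n`!%:R))%:E =
   (expR (- K * t) * ((t - c) ^+ n.+1 / n.+1`!%:R))%:E)%E.
Proof.
move=> c0 ct; have [<-|ctN] := eqVneq c t.
  rewrite subrr expr0n /= mul0r mulr0 (_ : step_set j c c = set0) ?integral_set0//.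
  by rewrite -subset0 => u [] cu uc _; move: (lt_le_trans cu uc); rewrite ltxx.
have {ctN}ct' : c < t by rewrite lt_neqAle ctN.
pose f (u : Omega) : R := expR (- K * (t - gap u)) * (`|t - gap u| ^+ n / n`!%:R).
have mf : measurable_fun [set: Omega] f.
  have mt : measurable_fun [set: Omega] (fun u : Omega => t - gap u).
    by apply: measurable_funB => //; exact: measurable_gap.
  apply: measurable_funM.
    by apply: measurableT_comp => //; exact: measurable_funM.
  by apply: measurable_funM => //; apply: measurable_funX; apply: measurableT_comp.
rewrite (eq_integral (fun u => (f u)%:E)); last first.
  move=> u; rewrite inE => -[_ ut _]; congr EFin; congr (_ * (_ ^+ _ / _)).
  by rewrite ger0_norm// subr_ge0.
rewrite step_set_integral//; last 2 first.
- exact/measurable_EFinP.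
- by move=> u; rewrite lee_fin mulr_ge0 ?expR_ge0// divr_ge0// exprn_ge0.
rewrite -(integral_log_power j n c0 ct').
set a := ((_ / K)%R); set b := ((_ / K)%R).
pose h (u : R) : R := expR (- K * t) / (K * u - j%:R) *
   ((t + ln (K * u - j%:R) / K) ^+ n / n`!%:R).
have fh u : u \in `[a, b[%classic -> h u = f u.
  rewrite inE => uab.
  have : ((`[0, 1] `&` step_set j c t) `\` lattice) u.
    by rewrite step_set_interval.
  move=> [[_ [_ ut _]] _].
  have v01 := step_interval_lt1 c0 uab; have /andP[v0 _] := v01.
  have [_ gu] := gapE v01.
  have e : t - gap u = t + ln (K * u - j%:R) / K by rewrite gu mulNr opprK.
  rewrite /f ger0_norm ?subr_ge0// e /h; congr (_ * _).
  rewrite (_ : - K * (t + ln (K * u - j%:R) / K) = - K * t - ln (K * u - j%:R)).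
    by rewrite expRD expRN lnK.
  by rewrite mulrDr; congr (_ + _); rewrite mulrC mulrN divfK.
rewrite -integral_itv_bndo_bndc; last first.
  apply: (@eq_measurable_fun _ _ _ _ _ (EFin \o f)).
    by move=> u /fh e; rewrite /= -e.
  by apply/measurable_EFinP; exact: measurable_funS mf.
by apply: eq_integral => u /fh e; rewrite -e.
Qed.

Lemma gap_le_prob c : 0 <= c -> P [set u | gap u <= c] = (1 - expR (- K * c))%:E.
Proof.
move=> c0.
have mE : measurable [set u : Omega | gap u <= c].
  rewrite -[X in measurable X]setTI.
  have := measurable_gap measurableT (measurable_itv `]-oo, c]).
  by rewrite set_itvE.
rewrite -[[set u | _]]setIT -integral_indic//.
rewrite (eq_integral (fun u => \sum_(j < k.+1) (\1_(step_set j 0 c) u)%:E)%E).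
  rewrite ge0_integral_sum//; last first.
    by move=> j; apply/measurable_EFinP; apply: measurable_indic; exact: measurable_step_set.
  transitivity (\sum_(j < k.+1) ((1 - expR (- K * c)) / K)%:E)%E; last first.
    by rewrite sumEFin sumr_const card_ord -[X in X%:E]mulr_natr divfK.
  apply: eq_bigr => j _.
  rewrite integral_indic//; last exact: measurable_step_set.
  rewrite setIT -[LHS]mul1e -integral_cst; last exact: measurable_step_set.
  rewrite step_set_integral// integral_cst// mul1e.
  apply: etrans; first exact: lebesgue_measure_itv.
  rewrite /=.
  have K0 : 0 < K by [].
  rewrite mulr0 expR0 lte_fin ltr_pM2r ?invr_gt0// ltrD2l -EFinB -mulrBl.
  rewrite [X in (X / K)%:E](_ : _ = 1 - expR (- K * c)); last ring.
  case: ifPn => // /negbTE; rewrite -expR0 ltr_expR mulNr oppr_lt0 pmulr_rgt0//.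
  move=> c0'; have -> : c = 0 by apply/eqP; rewrite eq_le c0 leNgt c0'.
  by rewrite mulr0 oppr0 subrr mul0r.
move=> u _; rewrite sumEFin; congr EFin; rewrite indicE.
rewrite (bigD1 (mark u))//= big1 ?addr0 => [|j jm]; last first.
  by rewrite indicE memNset// => -[_ _ mj]; move: jm; rewrite -mj eqxx.
by rewrite indicE; congr (_ : bool)%:R; apply/idP/idP; rewrite !inE /=;
  [move=> ?; split=> //; exact: gap_gt0|case].
Qed.

(** The probability of a word over an interval of length [D]: the number of arrivals is
    Poisson of parameter [K * D] and the marks are independent and uniform. *)
Definition poisson_weight (D : R) (u : seq 'I_k.+1) : R :=
  expR (- K * D) * (D ^+ size u / (size u)`!%:R).

Fixpoint weight (s : R) (r : seq (R * seq 'I_k.+1)) : R :=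
  if r is (t, u) :: r' then poisson_weight (t - s) u * weight t r' else 1.

Lemma weight_shift x s r : weight (s - x) (shift x r) = weight s r.
Proof.
elim: r s => [//|[t u] r IH] s /=.
by rewrite IH; congr (poisson_weight _ _ * _); ring.
Qed.

Lemma increasing_shift x s (r : seq (R * seq 'I_k.+1)) :
  increasing s r -> increasing (s - x) (shift x r).
Proof. by elim: r s => [//|[t u] r IH] s /= [st /IH]; rewrite lerD2r. Qed.

Lemma poisson_weight_ge0 D u : 0 <= D -> 0 <= poisson_weight D u.
Proof. by move=> D0; rewrite mulr_ge0 ?expR_ge0// divr_ge0// exprn_ge0. Qed.

Lemma weight_ge0 s r : increasing s r -> 0 <= weight s r.
Proof.
elim: r s => [//|[t u] r IH] s /= [st tr].
by rewrite mulr_ge0 ?IH// poisson_weight_ge0// subr_ge0.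
Qed.

(** On an explosive path all the gaps are bounded by a common [m].  The event [B m] that
    they are occurs when the first gap is at most [m] and the tail is in [B m] again,
    so [P (B m) = (1 - exp (- K m)) * P (B m)]. *)
Lemma non_explosive_prob : P (~` non_explosive) = 0%E.
Proof.
pose B m : set Omega := \bigcap_i [set w | gap_at i w <= m%:R].
have mB m : measurable (B m).
  apply: bigcapT_measurable => i.
  rewrite -[X in measurable X]setTI.
  have := measurable_gap_at i measurableT (measurable_itv `]-oo, m%:R]).
  by rewrite set_itvE.
have B0 m : P (B m) = 0%E.
  have BE : B m = @uniform_head R @^-1` [set u | gap u <= m%:R] `&`
      @uniform_tail R @^-1` B m.
    apply/seteqP; split=> w.
      move=> h; split; first exact: (h 0%N I).
      by move=> i _; have := h i.+1 I; rewrite /= /gap_at iterSr.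
    move=> [h0 h] [|i] _ //=; have := h i I; by rewrite /= /gap_at iterSr.
  have mg : measurable [set u : Omega | gap u <= m%:R].
    rewrite -[X in measurable X]setTI.
    have := measurable_gap measurableT (measurable_itv `]-oo, m%:R]).
    by rewrite set_itvE.
  have := uniform_head_tail mg (mB m).
  rewrite -BE gap_le_prob// => e.
  have fB : P (B m) \is a fin_num by rewrite fin_num_measure.
  move: e; rewrite -(fineK fB) -EFinM => -[e].
  congr EFin; have := expR_gt0 (- K * m%:R) => h.
  nra.
apply: measure_negligible; first exact: (measurableC measurable_non_explosive).
apply: (@negligibleS _ _ _ P (\bigcup_m B m)).
  move=> w /existsNP[m] /forallNP nm; exists m => // i _.
  have := nm i; move/negP; rewrite -leNgt; apply: le_trans.
  rewrite /arrival big_ord_recr /= lerDr sumr_ge0// => l _.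
  exact/ltW/gap_gt0.
apply: negligible_bigcup => m.
by exists (B m); split=> //; exact: B0.
Qed.

Lemma first_gap_prob c : 0 <= c ->
  P [set w | c < gap_at 0 w] = (expR (- K * c))%:E.
Proof.
move=> c0.
have mg : measurable [set u : Omega | gap u <= c].
  rewrite -[X in measurable X]setTI.
  have := measurable_gap measurableT (measurable_itv `]-oo, c]).
  by rewrite set_itvE.
have := uniform_head_tail mg (@measurableT _ Omega).
rewrite preimage_setT setIT probability_setT mule1 gap_le_prob// => e.
rewrite (_ : [set w | _] = ~` (@uniform_head R @^-1` [set u | gap u <= c])).
  rewrite probability_setC; last first.
    by rewrite -[X in measurable X]setTI; apply: measurable_uniform_head.
  by rewrite [X in (_ - X)%E]e -EFinB opprB addrC subrK.
by apply/seteqP; split=> w /=; rewrite ltNge => /negP.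
Qed.

Lemma non_explosive_setI (A : set Omega) : measurable A ->
  P (non_explosive `&` A) = P A.
Proof.
move=> mA; have mN := measurable_non_explosive.
rewrite [RHS](_ : _ = P (non_explosive `&` A) + P (~` non_explosive `&` A))%E.
  rewrite [X in (_ + X)%E](_ : _ = 0%E) ?adde0//.
  apply: (subset_measure0 _ _ _ non_explosive_prob) => //.
  - by apply: measurableI => //; exact: measurableC.
  - exact: measurableC.
rewrite -measureU -?setIUl ?setUv ?setTI//.
- exact: measurableI.
- by apply: measurableI => //; exact: measurableC.
- by rewrite setIACA setICr set0I.
Qed.

(** The induction measure of [history_prob]: it decreases both when an empty word is
    dropped and when a letter is removed, and shifting the times preserves it. *)
Definition total_size (r : seq (R * seq 'I_k.+1)) : nat :=
  sumn [seq (size p.2).+1 | p <- r].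

Lemma total_size_shift x r : total_size (shift x r) = total_size r.
Proof.
by rewrite /total_size; elim: r => [//|[t u] r IH] /=; rewrite IH.
Qed.

(** By renewal ([history_cons_word]) and Fubini, removing the first letter leads to an
    integral over the time of the first arrival, given by [step_set_poisson]. *)
Lemma history_prob c r : 0 <= c -> increasing c r ->
  P (history c r) = (expR (- K * c) * weight c r)%:E.
Proof.
have [n] := ubnP (total_size r).
elim: n r c => [//|n IH] [|[t [|j u]] r] c.
- move=> _ c0 _; rewrite history_nil mulr1 non_explosive_setI ?first_gap_prob//.
  rewrite -[X in measurable X]setTI.
  have := measurable_gap_at 0 measurableT (measurable_itv `]c, +oo[).
  by rewrite set_itvE.
- rewrite /total_size /= ltnS => rn c0 [ct tr].
  rewrite history_nil_word//= IH ?(le_trans c0)//.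
  rewrite /poisson_weight /= expr0 fact0 divr1 mulr1 mulrA -expRD.
  by congr (expR _ * _)%:E; ring.
rewrite /total_size /= addSn ltnS => rn c0 [ct tr].
pose M : set (Omega * Omega) := [set xy | step_set j c t xy.1 /\
   history 0 (shift (gap xy.1) ((t, u) :: r)) xy.2].
have mM : measurable M.
  apply: measurableI.
    rewrite -[X in measurable X]setTI.
    by apply: measurable_fst => //; exact: measurable_step_set.
  apply: measurable_history_shift; first exact: measurable_snd.
  exact: (measurableT_comp measurable_gap measurable_fst).
have -> : history c ((t, j :: u) :: r) =
    [set w | M (@uniform_head R w, @uniform_tail R w)].
  apply/seteqP; split=> w; first by move/(history_cons_word c j u w tr) => -[].
  by move=> [[h1 h2 h3] h4]; apply/(history_cons_word c j u w tr).
rewrite (@joint_law_product _ _ _ Omega Omega Omega R P P P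
  (@uniform_head R) (@uniform_tail R))//; last 3 first.
- exact: measurable_uniform_head.
- exact: measurable_uniform_tail.
- by move=> A B mA mB; exact: uniform_head_tail.
rewrite /product_measure1.
transitivity (\int[P]_(x in step_set j c t)
   ((weight t r)%:E * (poisson_weight (t - gap x) u)%:E))%E.
  rewrite [RHS]integral_mkcond; apply: eq_integral => x _.
  rewrite patchE /=; case: ifPn => [|nx].
    rewrite inE => hx; have [cx xt xj] := hx.
    rewrite (_ : xsection M x = history 0 (shift (gap x) ((t, u) :: r))); last first.
      by apply/seteqP; split=> y; rewrite /xsection /= inE => //= -[].
    rewrite IH//.
    - by rewrite mulr0 expR0 mul1r /= subr0 weight_shift EFinM muleC.
    - by rewrite total_size_shift.
    - by rewrite /= subr_ge0; split=> //; exact: increasing_shift.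
  rewrite (_ : xsection M x = set0) ?measure0//.
  rewrite -subset0 => y; rewrite /xsection /= inE => -[hx _].
  by move: nx; rewrite notin_setE => /(_ hx).
rewrite ge0_integralZl//; last 4 first.
- exact: measurable_step_set.
- apply/measurable_EFinP; apply: measurable_funS (measurableT) _ _ => //.
  have mt : measurable_fun [set: Omega] (fun u : Omega => t - gap u).
    by apply: measurable_funB => //; exact: measurable_gap.
  apply: measurable_funM.
    by apply: measurableT_comp => //; exact: measurable_funM.
  by apply: measurable_funM => //; exact: measurable_funX.
- by move=> x [_ xt _]; rewrite lee_fin poisson_weight_ge0// subr_ge0.
- by rewrite lee_fin weight_ge0.
rewrite step_set_poisson// -EFinM; congr EFin.
have -> : - K * t = - K * c + - K * (t - c) by ring.
by rewrite expRD /= /poisson_weight /=; ring.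
Qed.

Lemma measurable_word_eq s t u : measurable [set w : Omega | word s t w = u].
Proof.
exact: (@measurable_word _ Omega id (@measurable_id _ _ _) (cst s) (cst t) u).
Qed.

(** The words over [[0, t 0]], of arbitrary value, complete the ones at hand to a history
    starting at time 0; summing over that value disintegrates the event. *)
Lemma word_joint n (t : nat -> R) (u : nat -> seq 'I_k.+1) :
  0 <= t 0%N -> (forall i, (i < n)%N -> t i <= t i.+1) ->
  P (\bigcap_(i < n) [set w | word (t i) (t i.+1) w = u i]) =
  (\prod_(i < n) poisson_weight (t i.+1 - t i) (u i))%:E.
Proof.
move=> t0 tn.
set E := \bigcap_(i < n) _.
pose r m l := [seq (t i.+1, u i) | i <- iota m l].
have chainE m l w : chain (t m) (r m l) w <->
    forall i, (m <= i < m + l)%N -> word (t i) (t i.+1) w = u i.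
  elim: l m => [|l IH] m /=; first by split=> // _ i; lia.
  rewrite IH; split=> [[h1 h2] i|h].
    move=> /andP[]; rewrite leq_eqVlt => /orP[/eqP<-//|mi il].
    by apply: h2; lia.
  by split=> [|i mi]; apply: h; lia.
have incr m l : (m + l <= n)%N -> increasing (t m) (r m l).
  elim: l m => [//|l IH] m mn /=; split; first by apply: tn; lia.
  by apply: IH; lia.
have weightE m l : weight (t m) (r m l) =
    \prod_(m <= i < m + l) poisson_weight (t i.+1 - t i) (u i).
  elim: l m => [|l IH] m /=; first by rewrite addn0 big_geq.
  rewrite IH [RHS]big_ltn; last by lia.
  by rewrite addSnnS.
have mE : measurable E.
  by apply: bigcap_measurableType => i _; exact: measurable_word_eq.
have hist v l : (l <= n)%N ->
    P ([set w | forall i, (0 <= i < l)%N -> word (t i) (t i.+1) w = u i] `&`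
       [set w | word 0 (t 0%N) w = v]) =
    (poisson_weight (t 0%N) v *
     \prod_(0 <= i < l) poisson_weight (t i.+1 - t i) (u i))%:E.
  move=> ln; rewrite -non_explosive_setI; last first.
    apply: measurableI; last exact: measurable_word_eq.
    rewrite (_ : [set _ | _] = \bigcap_(i in [set i | (0 <= i < l)%N])
      [set w | word (t i) (t i.+1) w = u i])//.
    by apply: bigcap_measurableType => i _; exact: measurable_word_eq.
  rewrite (_ : _ `&` _ = history 0 ((t 0%N, v) :: r 0%N l)).
    rewrite history_prob//=; last by split=> //; exact: incr.
    by rewrite mulr0 expR0 mul1r subr0 weightE.
  apply/seteqP; split=> w.
    move=> [g [h1 h2]]; split=> //; first exact: count0.
    by split=> //; apply/chainE.
  move=> [g _ [h1 h2]]; split=> //; split=> //.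
  by move/chainE : h2.
have word0 v : P [set w | word 0 (t 0%N) w = v] = (poisson_weight (t 0%N) v)%:E.
  have := hist v 0%N (leq0n n); rewrite big_geq// mulr1 => <-.
  by congr (P _); apply/seteqP; split=> w [].
have := @discrete_disintegration _ Omega R P _ (word 0 (t 0%N)) (word 0 (t 0%N)) E
  (\prod_(i < n) poisson_weight (t i.+1 - t i) (u i))%:E
  (measurable_word_eq 0 (t 0%N)) (measurable_word_eq 0 (t 0%N)) mE isT _ setT.
rewrite preimage_setT setIT probability_setT mule1; apply=> v.
rewrite [X in (_ * X)%E](word0 v) -EFinM mulrC.
have := hist v n (leqnn n); rewrite big_mkord => <-.
by congr (P _).
Qed.

Lemma word_prob s t u : 0 <= s -> s <= t ->
  P [set w | word s t w = u] = (poisson_weight (t - s) u)%:E.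
Proof.
move=> s0 st.
have := @word_joint 1 (fun i => if i is 0%N then s else t) (fun=> u) s0.
rewrite big_ord1 => <-; last by case.
by rewrite bigcap_mkord big_ord1.
Qed.

(** * The associated pure jump Levy process *)

Section jumps.
Context (d : nat) (b : 'I_k.+1 -> 'cV[R]_d).

Definition jump_sum (u : seq 'I_k.+1) : 'cV[R]_d := \sum_(j <- u) b j.

Definition jump_process (t : R) (w : Omega) : 'cV[R]_d := jump_sum (word 0 t w).

Lemma jump_process_increment s t w : 0 <= s -> s <= t ->
  jump_process t w - jump_process s w = jump_sum (word s t w).
Proof.
move=> s0 st; rewrite /jump_process (word_cat w s0 st) /jump_sum big_cat /=.
by rewrite addrAC subrr add0r.
Qed.

Lemma word_refl t w : word t t w = [::].
Proof. by apply/nilP; rewrite /nilp size_word subnn. Qed.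

Lemma jump_process0 w : jump_process 0 w = 0.
Proof. by rewrite /jump_process word_refl /jump_sum big_nil. Qed.

Lemma jump_process_random_vector t : random_vector (jump_process t).
Proof.
move=> B _; rewrite (_ : _ @^-1` B = word 0 t @^-1` (jump_sum @^-1` B))//.
by apply: measurable_discrete; exact: measurable_word_eq.
Qed.

Lemma jump_process_independent_increments :
  independent_increments P jump_process.
Proof.
move=> n t t0 tn B _.
have t_ge0 i : (i <= n)%N -> 0 <= t i.
  elim: i => [//|i IH] ni; apply: le_trans (IH (ltnW ni)) _.
  exact/ltW/tn.
have E i : (i < n)%N ->
    (fun w => jump_process (t i.+1) w - jump_process (t i) w) @^-1` B i =
    word (t i) (t i.+1) @^-1` (jump_sum @^-1` B i).
  move=> ni; apply/seteqP; split=> w /=;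
    by rewrite jump_process_increment ?t_ge0 ?(ltW (tn _ ni)) ?(ltnW ni).
rewrite (eq_bigcapr E) (eq_bigr (fun i : 'I_n =>
    P (word (t i) (t i.+1) @^-1` (jump_sum @^-1` B i)))); last first.
  by move=> i _; rewrite E.
apply: (@discrete_independent _ Omega R P _ [::] n
  (fun i => word (t i) (t i.+1))).
  by move=> i c; exact: measurable_word_eq.
move=> c; apply: etrans.
  by apply: word_joint => // i ni; exact/ltW/tn.
rewrite -prodEFin; apply: eq_bigr => i _.
rewrite -[LHS]word_prob//; first exact: t_ge0 (ltnW (ltn_ord i)).
exact/ltW/tn.
Qed.

Lemma jump_process_stationary_increments :
  stationary_increments P jump_process.
Proof.
move=> s t s0 t0 B _.
rewrite (_ : _ @^-1` B = word s (s + t) @^-1` (jump_sum @^-1` B)); last first.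
  by apply/seteqP; split=> w /=; rewrite jump_process_increment// lerDl.
rewrite [X in _ = P X](_ : _ = word 0 t @^-1` (jump_sum @^-1` B)); last first.
  by apply/seteqP; split=> w /=; rewrite jump_process_increment.
apply: (@discrete_same_law _ Omega R P).
- exact: measurable_word_eq.
- exact: measurable_word_eq.
move=> c; apply: (@etrans _ _ (poisson_weight (s + t - s) c)%:E).
  by apply: word_prob; rewrite // lerDl.
rewrite addrAC subrr add0r -[t in poisson_weight t]subr0.
by apply/esym/word_prob.
Qed.

Lemma word_neq_prob s t : 0 <= s -> s <= t ->
  P [set w | word s t w <> [::]] = (1 - expR (- K * (t - s)))%:E.
Proof.
move=> s0 st.
rewrite (_ : [set w | _] = ~` [set w | word s t w = [::]])//.
rewrite probability_setC; last exact: measurable_word_eq.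
rewrite [X in (_ - X)%E](word_prob [::] s0 st).
by rewrite /poisson_weight expr0 fact0 divr1 mulr1 EFinB.
Qed.

(** The process moves between [s] and [t] only if there is an arrival, which has
    probability [1 - exp (- K |s - t|)]. *)
Lemma jump_process_stochastically_continuous :
  stochastically_continuous P jump_process.
Proof.
move=> t e t0 e0.
have ub s : 0 <= s ->
    (P [set w | (e < `|jump_process s w - jump_process t w|)%R] <=
     (1 - expR (- K * `|s - t|))%:E)%E.
  move=> s0.
  have m A : measurable ([set w | A (word 0 s w, word 0 t w)] : set Omega).
    apply: (@measurable_discrete _ Omega _ (fun w => (word 0 s w, word 0 t w))) => -[u v].
    rewrite (_ : [set _ | _] = [set w | word 0 s w = u] `&` [set w | word 0 t w = v]).
      by apply: measurableI; exact: measurable_word_eq.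
    by apply/seteqP; split=> w /= [-> ->].
  have mN x y : measurable [set w | word x y w <> [::]].
    exact: measurableC (measurable_word_eq x y [::]).
  have mJ := m [set uv | e < `|jump_sum uv.1 - jump_sum uv.2|].
  have [st|/ltW ts] := leP s t.
    rewrite distrC ger0_norm ?subr_ge0// -word_neq_prob//.
    apply: le_measure; rewrite ?inE//.
    move=> w /= + wst; rewrite distrC jump_process_increment// wst.
    by rewrite /jump_sum big_nil normr0 ltNge ltW.
  rewrite ger0_norm ?subr_ge0// -word_neq_prob//.
  apply: le_measure; rewrite ?inE//.
  move=> w /= + wst; rewrite jump_process_increment// wst.
  by rewrite /jump_sum big_nil normr0 ltNge ltW.
apply: (@squeeze_cvge _ _ _ _ (cst 0%E) _ (fun s => (1 - expR (- K * `|s - t|))%:E)).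
- have : \forall s \near within [set s | 0 <= s] (nbhs t), 0 <= s.
    exact: near_withinT.
  by apply: filterS => s s0; rewrite measure_ge0 ub.
- exact: cvg_cst.
apply: cvg_EFin; first exact: nearW.
apply: (cvg_trans (cvg_app _ (@cvg_within _ _ _ _))).
have -> : 0 = 1 - expR (- K * `|t - t|) :> R.
  by rewrite subrr normr0 mulr0 expR0 subrr.
apply: cvgB; first exact: cvg_cst.
apply: continuous_cvg; first exact: continuous_expR.
apply: cvgM; first exact: cvg_cst.
apply: (@cvg_norm _ R^o); apply: cvgB; first exact: cvg_id.
exact: cvg_cst.
Qed.

End jumps.

Section jumps2.
Context (d : nat) (b : 'I_k.+1 -> 'cV[R]_d).

(** On a path that does not explode the number of arrivals is locally constant on both
    sides of each time. *)
Lemma jump_process_cadlag w : non_explosive w -> cadlag (jump_process b ^~ w).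
Proof.
move=> g; split=> t t0.
  apply: cvg_near_cst.
  have ta : t < arrival (count t w) w by rewrite -count_le.
  near=> s.
  have ts : t <= s by near: s; exact: nbhs_right_ge.
  have sa : s < arrival (count t w) w by near: s; exact: nbhs_right_lt.
  rewrite /jump_process /word; congr (jump_sum _ [seq _ | i <- index_iota _ _]).
  by apply/eqP; rewrite eqn_leq count_le// sa le_count.
have ex : exists n, t <= arrival n w.
  by have [n tn] := non_explosive_exists t g; exists n; exact: ltW.
case: (ex_minnP ex) => n tn nmin.
apply: (@is_cvg_near_cst _ _ (jump_sum b [seq mark_at i w | i <- index_iota 0 n])).
have mn : n = 0%N \/ exists m, n = m.+1.
  by case: (n) => [|m]; [left|right; exists m].
have near_count : \forall s \near t^'-, (n <= count s w)%N.
  case: mn => [->|[m nm]]; first exact: filterE.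
  have mt : arrival m w < t.
    by rewrite ltNge; apply/negP => /nmin; rewrite nm ltnn.
  apply: filterS (nbhs_left_gt mt) => s ms.
  by rewrite nm ltnNge count_le// -leNgt ltW.
near=> s.
have st : s < t by near: s; exact: nbhs_left_lt.
have ns : (n <= count s w)%N by near: s.
rewrite /jump_process /word count0.
congr (jump_sum _ [seq _ | i <- index_iota _ _]).
by apply/eqP; rewrite eqn_leq ns andbT count_le// (lt_le_trans st).
Unshelve. all: by end_near. Qed.

Lemma jump_process_levy : levy_process P (jump_process b).
Proof.
split.
- by move=> t _; exact: jump_process_random_vector.
- by apply: aeW => w; exact: jump_process0.
- split; first exact: jump_process_independent_increments.
  exact: jump_process_stationary_increments.
- exact: jump_process_stochastically_continuous.
- exists (~` non_explosive); split.
  + exact: (measurableC measurable_non_explosive).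
  + exact: non_explosive_prob.
  + by move=> w /=; apply: contra_not => /jump_process_cadlag.
Qed.

End jumps2.

(** Each component is itself a jump process, with real jumps. *)
Lemma jump_process_subordinator d (b : 'I_k.+1 -> 'cV[R]_d) :
  (forall j i, 0 <= b j i 0) -> multivariate_subordinator P (jump_process b).
Proof.
move=> b0; split; first exact: jump_process_levy.
move=> i; split.
  rewrite (_ : (fun t w => _) =
    jump_process (fun j => const_mx (b j i 0) : 'cV[R]_1)).
    exact: jump_process_levy.
  apply/funext => t; apply/funext => w; apply/matrixP => x y.
  rewrite !mxE /jump_process /jump_sum !summxE.
  by apply: eq_bigr => j _; rewrite mxE.
apply: aeW => w s t s0 st.
rewrite -subr_ge0.
have := jump_process_increment b w s0 st.
move/(congr1 (fun v : 'cV_d => v i 0)); rewrite !mxE => ->.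
by rewrite summxE sumr_ge0.
Qed.

(** * Moments of the jump process *)

Lemma measurable_word_fun (f : seq 'I_k.+1 -> R) s t :
  measurable_fun [set: Omega] (fun w => f (word s t w)).
Proof.
move=> _ A _; rewrite setTI.
rewrite (_ : _ @^-1` A = word s t @^-1` (f @^-1` A))//.
by apply: measurable_discrete; exact: measurable_word_eq.
Qed.

(** Given that there are [n] arrivals, all the words of length [n] are equally likely. *)
Lemma word_expectation (f : seq 'I_k.+1 -> R) : (forall u, 0 <= f u) ->
  (\int[P]_w (f (word 0 1 w))%:E =
   \sum_(0 <= n <oo) (expR (- K) / n`!%:R * \sum_(u : n.-tuple 'I_k.+1) f u)%:E)%E.
Proof.
move=> f0.
pose F n : set Omega := [set w | size (word 0 1 w) = n].
have mF n : measurable (F n).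
  rewrite (_ : F n = word 0 1 @^-1` [set u | size u = n])//.
  by apply: measurable_discrete; exact: measurable_word_eq.
have UF : [set: Omega] = \bigcup_n F n.
  by apply/seteqP; split=> // w _; exists (size (word 0 1 w)).
rewrite UF ge0_integral_bigcup//; last 3 first.
- by rewrite -UF; apply/measurable_EFinP; exact: measurable_word_fun.
- by move=> w _; rewrite lee_fin.
- by apply/trivIsetP => i j _ _ ij; rewrite -subset0 => w [wi wj]; move: ij; rewrite -wi -wj eqxx.
apply: eq_eseriesr => n _.
rewrite (eq_integral (fun w =>
    \sum_(u : n.-tuple 'I_k.+1) (f u * \1_[set w | word 0 1 w = u] w)%:E)%E); last first.
  move=> w; rewrite inE => wn; rewrite sumEFin; congr EFin.
  have sz : size (word 0 1 w) == n by apply/eqP.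
  rewrite (bigD1 (Tuple sz))//= big1 ?addr0 => [|u uw]; last first.
    rewrite indicE memNset ?mulr0// => /= wu; move/eqP: uw; apply.
    by apply/val_inj.
  by rewrite indicE mem_set// mulr1.
have m1 (u : seq 'I_k.+1) :
    measurable_fun [set: Omega] (\1_[set w | word 0 1 w = u] : Omega -> R).
  by apply: measurable_indic; exact: measurable_word_eq.
rewrite ge0_integral_sum//; last 2 first.
- move=> u; apply/measurable_EFinP; apply: measurable_funM => //.
  exact: measurable_funS (m1 u).
- by move=> u w _; rewrite lee_fin mulr_ge0.
rewrite mulr_sumr -sumEFin; apply: eq_bigr => u _.
under eq_integral do rewrite EFinM.
rewrite ge0_integralZl//; last 2 first.
- by apply/measurable_EFinP; exact: measurable_funS (m1 u).
- by rewrite lee_fin.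
rewrite integral_indic//; last exact: measurable_word_eq.
rewrite (_ : _ `&` _ = [set w | word 0 1 w = u]); last first.
  apply/seteqP; split=> [w []//|w /= e]; split=> //.
  by rewrite /F /= e size_tuple.
rewrite [X in (_ * X)%E](_ : _ = (poisson_weight (1 - 0) u)%:E); last exact: word_prob.
rewrite -EFinM; congr EFin; rewrite /poisson_weight subr0 mulr1 expr1n size_tuple.
by rewrite mul1r mulrC.
Qed.

Lemma sum_tupleS n (f : seq 'I_k.+1 -> R) :
  \sum_(u : n.+1.-tuple 'I_k.+1) f u =
  \sum_(j < k.+1) \sum_(u : n.-tuple 'I_k.+1) f (j :: u).
Proof.
rewrite pair_bigA /=.
rewrite (reindex (fun p : 'I_k.+1 * n.-tuple 'I_k.+1 => [tuple of p.1 :: p.2])) //=.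
exists (fun u => (thead u, [tuple of behead u])) => [[j u] _|u _] /=.
  by congr (_, _); apply/val_inj.
by case/tupleP: u => a v; apply/val_inj; rewrite /= theadE.
Qed.

Lemma sum_tuple_cst n c : \sum_(u : n.-tuple 'I_k.+1) c = K ^+ n * c.
Proof.
by rewrite sumr_const card_tuple card_ord -[LHS]mulr_natl natrX.
Qed.

Lemma sum_tuple_linear n (x : 'I_k.+1 -> R) :
  \sum_(u : n.-tuple 'I_k.+1) \sum_(j <- u) x j =
  n%:R * (K ^+ n / K * \sum_j x j).
Proof.
have K0 : K != 0 by rewrite pnatr_eq0.
elim: n => [|n IH].
  by rewrite mul0r big1// => u _; rewrite tuple0 big_nil.
rewrite (sum_tupleS n (fun u => \sum_(j <- u) x j)).
under eq_bigr do under eq_bigr do rewrite big_cons.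
under eq_bigr do rewrite big_split sum_tuple_cst IH.
rewrite big_split /= -mulr_sumr sumr_const card_ord -[X in _ + X]mulr_natl.
set s := \sum_j x j; rewrite exprS -[n.+1%:R]natr1.
by field.
Qed.

Section sums.
Context (x y : 'I_k.+1 -> R).
Let X (u : seq 'I_k.+1) := \sum_(j <- u) x j.
Let Y (u : seq 'I_k.+1) := \sum_(j <- u) y j.

(** On average over the words of length [n], each of the [n] pairs of equal positions
    contributes the mean of the [x j * y j], and each of the [n * (n - 1)] other pairs
    the product of the means of [x] and [y]. *)
Lemma sum_tuple_quadratic n :
  \sum_(u : n.-tuple 'I_k.+1) X u * Y u =
  n%:R * (K ^+ n / K * \sum_j x j * y j) +
  n%:R * (n%:R - 1) * (K ^+ n / K ^+ 2 * ((\sum_j x j) * \sum_j y j)).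
Proof.
have K0 : K != 0 by rewrite pnatr_eq0.
elim: n => [|n IH].
  by rewrite !mul0r addr0 big1// => u _; rewrite tuple0 /X big_nil mul0r.
rewrite (sum_tupleS n (fun u => X u * Y u)).
have E j : \sum_(u : n.-tuple 'I_k.+1) X (j :: u) * Y (j :: u) =
    K ^+ n * (x j * y j) + x j * \sum_(u : n.-tuple 'I_k.+1) Y u +
    (y j * \sum_(u : n.-tuple 'I_k.+1) X u +
     \sum_(u : n.-tuple 'I_k.+1) X u * Y u).
  rewrite -sum_tuple_cst !mulr_sumr -!big_split /=; apply: eq_bigr => u _.
  by rewrite /X /Y !big_cons; ring.
rewrite (eq_bigr _ (fun j _ => E j)) !big_split /= -!mulr_suml -mulr_sumr.
rewrite sumr_const card_ord -[X in _ + (_ + X)]mulr_natl IH.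
rewrite !sum_tuple_linear.
set s := \sum_j x j; set t := \sum_j y j; set r := \sum_j x j * y j.
by rewrite [K ^+ n.+1]exprS -[n.+1%:R]natr1; field.
Qed.

End sums.

Definition poisson_mass n : R := expR (- K) / n`!%:R * K ^+ n.

Lemma poisson_mass_ge0 n : 0 <= poisson_mass n.
Proof. by rewrite mulr_ge0 ?exprn_ge0// divr_ge0 ?expR_ge0. Qed.

Lemma poisson_mass_total :
  (\sum_(0 <= n <oo) (poisson_mass n)%:E = 1 :> \bar R)%E.
Proof.
have := @word_expectation (fun=> 1) (fun=> ler01).
rewrite integral_cst// mul1e => h.
rewrite -[RHS](@probability_setT _ _ _ P).
apply: etrans (esym h); apply: eq_eseriesr => n _.
by rewrite sum_tuple_cst mulr1.
Qed.

(** Factorial moments of the Poisson law are computed by such shifts of the index. *)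
Lemma nneseries_shift (g h : nat -> R) c : (forall n, 0 <= g n) -> 0 <= c ->
  (forall n, 0 <= h n) -> g 0%N = 0 -> (forall n, g n.+1 = c * h n) ->
  (\sum_(0 <= n <oo) (g n)%:E = c%:E * \sum_(0 <= n <oo) (h n)%:E)%E.
Proof.
move=> g0 c0 h0 gz gS.
rewrite nneseries_recl// => [|n _]; last by rewrite lee_fin.
rewrite gz add0e -(@nneseries_addn _ (fun n => (g n)%:E) 1) => [|n]; last first.
  by rewrite lee_fin.
rewrite -nneseriesZl => [|n _]; last by rewrite lee_fin.
by apply: eq_eseriesr => n _; rewrite addn1 gS EFinM.
Qed.

Lemma poisson_massS n : n.+1%:R * poisson_mass n.+1 = K * poisson_mass n.
Proof.
rewrite /poisson_mass factS natrM exprS.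
have n0 : n.+1%:R != 0 :> R by rewrite pnatr_eq0.
have f0 : n`!%:R != 0 :> R by rewrite pnatr_eq0 -lt0n fact_gt0.
move: n0 f0; move: (n.+1%:R : R) (n`!%:R : R) => N f N0 f0.
by field; rewrite N0 f0.
Qed.

Lemma poisson_mass_mean :
  (\sum_(0 <= n <oo) (n%:R * poisson_mass n)%:E = K%:E :> \bar R)%E.
Proof.
rewrite (@nneseries_shift _ poisson_mass K).
- by rewrite poisson_mass_total mule1.
- by move=> n; rewrite mulr_ge0 ?poisson_mass_ge0.
- by [].
- exact: poisson_mass_ge0.
- by rewrite mul0r.
- exact: poisson_massS.
Qed.

Lemma poisson_mass_square :
  (\sum_(0 <= n <oo) (n%:R * (n%:R - 1) * poisson_mass n)%:E = (K * K)%:E :> \bar R)%E.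
Proof.
rewrite (@nneseries_shift _ (fun n => n%:R * poisson_mass n) K).
- by rewrite poisson_mass_mean EFinM.
- case=> [|n]; first by rewrite !mul0r.
  by rewrite mulr_ge0 ?poisson_mass_ge0// mulr_ge0// subr_ge0 ler1n.
- by [].
- by move=> n; rewrite mulr_ge0 ?poisson_mass_ge0.
- by rewrite !mul0r.
- move=> n; rewrite mulrAC poisson_massS -[n.+1%:R]natr1 addrK; ring.
Qed.

Section moments.
Context (x y : 'I_k.+1 -> R).
Context (x0 : forall j, 0 <= x j) (y0 : forall j, 0 <= y j).
Let X (u : seq 'I_k.+1) := \sum_(j <- u) x j.
Let Y (u : seq 'I_k.+1) := \sum_(j <- u) y j.

Let K0 : K != 0. Proof. by rewrite pnatr_eq0. Qed.

Lemma word_mean : (\int[P]_w (X (word 0 1 w))%:E = (\sum_j x j)%:E)%E.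
Proof.
rewrite word_expectation => [|u]; last by rewrite sumr_ge0.
set s := \sum_j x j.
rewrite (eq_eseriesr (g := fun n => (s / K)%:E * (n%:R * poisson_mass n)%:E)%E).
  rewrite nneseriesZl => [|n _]; last first.
    by rewrite lee_fin mulr_ge0 ?poisson_mass_ge0.
  by rewrite poisson_mass_mean -EFinM divfK.
move=> n _; rewrite -EFinM sum_tuple_linear -/s /poisson_mass; congr EFin.
by field; rewrite nat1r K0 pnatr_eq0 -lt0n fact_gt0.
Qed.

Lemma word_second_moment :
  (\int[P]_w (X (word 0 1 w) * Y (word 0 1 w))%:E =
   (\sum_j x j * y j + (\sum_j x j) * \sum_j y j)%:E)%E.
Proof.
rewrite (word_expectation (f := fun u => X u * Y u)) => [|u]; last first.
  by rewrite mulr_ge0 ?sumr_ge0.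
set s := \sum_j x j; set t := \sum_j y j; set r := \sum_j x j * y j.
have s0 : 0 <= s by exact: sumr_ge0.
have t0 : 0 <= t by exact: sumr_ge0.
have r0 : 0 <= r by apply: sumr_ge0 => j _; rewrite mulr_ge0.
rewrite (eq_eseriesr (g := fun n => (r / K)%:E * (n%:R * poisson_mass n)%:E +
   (s * t / K ^+ 2)%:E * (n%:R * (n%:R - 1) * poisson_mass n)%:E)%E).
  have a0 n : 0 <= n%:R * poisson_mass n by rewrite mulr_ge0 ?poisson_mass_ge0.
  have b0 n : 0 <= n%:R * (n%:R - 1) * poisson_mass n.
    case: n => [|n]; first by rewrite !mul0r.
    by rewrite mulr_ge0 ?poisson_mass_ge0// mulr_ge0// subr_ge0 ler1n.
  rewrite nneseriesD => [|n _ _|n _ _]; last 2 first.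
  - by rewrite -EFinM lee_fin mulr_ge0// divr_ge0.
  - by rewrite -EFinM lee_fin mulr_ge0// divr_ge0// mulr_ge0.
  rewrite !nneseriesZl => [|n _|n _]; rewrite ?lee_fin//.
  rewrite poisson_mass_mean poisson_mass_square -!EFinM -EFinD; congr EFin.
  by field.
move=> n _; rewrite -!EFinM -EFinD sum_tuple_quadratic -/s -/t -/r /poisson_mass.
congr EFin; have f0 : n`!%:R != 0 :> R by rewrite pnatr_eq0 -lt0n fact_gt0.
by field; rewrite nat1r K0 f0.
Qed.

End moments.

End arrivals.

(** * Completely positive matrices as covariance matrices *)

Lemma Lfun2_of_square disp (T : measurableType disp) (R : realType)
    (P : probability T R) (X : T -> R) :
  measurable_fun setT X -> (\int[P]_w (X w * X w)%:E < +oo)%E ->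
  X \in Lfun P 2%:E.
Proof.
move=> mX X2; rewrite inE; apply/andP; split; rewrite inE//=.
rewrite /finite_norm unlock /=; apply: poweR_lty.
rewrite (eq_integral (fun w => (X w * X w)%:E))// => w _ /=.
by rewrite powR_mulrn// real_normK ?num_real// expr2.
Qed.

(** The jumps are the columns of a factor of [C], together with a zero jump that makes the
    set of marks non-empty. *)
Theorem completely_positive_is_var (R : realType) (d : nat) (C : 'M[R]_d) :
  completely_positive C -> is_var_of_subordinator C.
Proof.
move=> [k [B [B0 CB]]].
pose b (j : 'I_k.+1) : 'cV[R]_d :=
  if unlift ord0 j is Some j' then col j' B else 0.
have b0 j i : 0 <= b j i 0 by rewrite /b; case: unlift => [l|]; rewrite mxE.
pose P := uniform_prob (@ltr01 R).
have XE i w : jump_process b 1 w i 0 = \sum_(j <- word k 0 1 w) b j i 0.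
  by rewrite /jump_process /jump_sum summxE.
have mX i : measurable_fun setT (fun w => jump_process b 1 w i 0).
  under eq_fun do rewrite XE.
  exact: (measurable_word_fun (fun u => \sum_(j <- u) b j i 0)).
have M1 i : (\int[P]_w (jump_process b 1 w i 0)%:E = (\sum_j b j i 0)%:E)%E.
  by under eq_integral do rewrite XE; rewrite word_mean.
have M2 i j : (\int[P]_w (jump_process b 1 w i 0 * jump_process b 1 w j 0)%:E =
    (\sum_l b l i 0 * b l j 0 + (\sum_l b l i 0) * (\sum_l b l j 0))%:E)%E.
  under eq_integral do rewrite !XE.
  exact: (word_second_moment (x := fun l => b l i 0) (y := fun l => b l j 0)).
have L2 : finite_second_moments P (jump_process b 1).
  by move=> i; apply: Lfun2_of_square => //; rewrite M2 ltry.
exists _, (measurableTypeR R), P, (jump_process b); split=> //.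
  exact: jump_process_subordinator.
have L1 i : (fun w => jump_process b 1 w i 0) \in Lfun P 1.
  by apply: Lfun_subset12 (L2 i); rewrite fin_num_measure.
apply/matrixP => i j; rewrite mxE.
rewrite (covarianceE (L1 i) (L1 j) (Lfun2_mul_Lfun1 (L2 i) (L2 j))).
rewrite !unlock [X in (X - _)%E]M2 !M1 -EFinM -EFinB /= addrK.
rewrite CB mxE big_ord_recl /b unlift_none mxE mul0r add0r.
by apply: eq_bigr => l _; rewrite liftK !mxE.
Qed.

Theorem proposition5p2 (R : realType) (d : nat) :
  [/\ (forall (disp : measure_display) (T : measurableType disp)
              (P : probability T R) (L : R -> T -> 'cV[R]_d),
         multivariate_subordinator P L -> finite_second_moments P (L 1) ->
         completely_positive (var P (L 1))),
      (forall C : 'M[R]_d, completely_positive C -> is_var_of_subordinator C),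
      (forall C : 'M[R]_d, is_var_of_subordinator C <-> completely_positive C)
    & ((d <= 4)%N -> forall C : 'M[R]_d,
         is_var_of_subordinator C <-> doubly_nonnegative C)].
Proof.
have varCP C : is_var_of_subordinator C -> completely_positive C.
  move=> [disp [T [P [L [Lsub L2 <-]]]]].
  exact: var_subordinator_completely_positive.
split.
- by move=> disp T P L; exact: var_subordinator_completely_positive.
- by move=> C; exact: completely_positive_is_var.
- by move=> C; split; [exact: varCP|exact: completely_positive_is_var].
- move=> d4 C; split=> [/varCP|CD].
    exact: completely_positive_doubly_nonnegative.
  apply: completely_positive_is_var.
  exact: doubly_nonnegative_completely_positive.
Qed.
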